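(* For every fixed integer $k\ge 2$, $$F_k(n)=\Theta(\alpha(k)^n)\quad\text{as } n\to\infty,\qquad \alpha(k)=\frac{k-1+\sqrt{(k-1)^2+4}}{2},$$ where $F_k(n)$ is the maximum number of directed cycles in a directed multigraph with $n$ vertices, outdegree exactly $k$ at every vertex, in which edges connecting distinct vertices have multiplicity at most $k-1$. In particular, $F_2(n)=\Theta(F_n)$, where $F_n$ denotes the $n$-th Fibonacci number.
   Context: A digraph is a finite directed graph possibly containing multi-edges and self-loops. $\mathcal G_{\text{multi}}^{n,k}$ is the set of all digraphs with $n$ vertices in which every vertex has outdegree exactly $k$ (counted with multiplicity, self-loops included), and for each ordered pair of distinct vertices $(u,v)$ the multiplicity of the edge from $u$ to $v$ is at most $k-1$ (self-loops may have any multiplicity). A cycle is a directed cycle (no repeated vertices; a self-loop is a cycle of length 1). $C(G)$ is the number of cycles of $G$, counted with multiplicity: cycles using different parallel edges of the same multi-edge are distinct. $F_k(n)=\max_{G\in\mathcal G_{\text{multi}}^{n,k}}C(G)$. *)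

(* Defs.v *)
From mathcomp Require Import all_boot all_order all_algebra.
From mathcomp Require Import all_classical all_reals all_analysis.

Set Implicit Arguments.
Unset Strict Implicit.
Unset Printing Implicit Defensive.

(* A digraph on the vertex set 'I_n, possibly with parallel edges and
   self-loops, given by its adjacency matrix: G u v is the multiplicity of the
   edge from u to v. *)
Definition digraph n := 'M[nat]_n.

Section Digraph.
Variables (n : nat) (G : digraph n).

(* Parallel edges are distinct elements: Tagged _ i : edge, with tag (u, v), is
   the i-th of the G u v edges from u to v. *)
Definition edge : Type := {uv : 'I_n * 'I_n & 'I_(G uv.1 uv.2)}.

Definition source (e : edge) : 'I_n := (tag e).1.
Definition target (e : edge) : 'I_n := (tag e).2.

Definition outdegree (u : 'I_n) : nat := \sum_(v < n) G u v.

(* A closed walk that repeats no vertex, as the cyclic sequence of its edges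
   (path.cycle also accepts the empty sequence, which is not a cycle of G). *)
Definition is_cycle_seq (c : seq edge) : bool :=
  [&& c != [::], cycle (fun e f => target e == source f) c
    & uniq [seq source e | e <- c]].

(* Cycles are taken up to the choice of the starting point, hence identified
   with their edge sets; a cycle that repeats no vertex has at most n edges. *)
Definition is_cycle (A : {set edge}) : bool :=
  [exists r : 'I_n.+1, exists c : r.-tuple edge,
     is_cycle_seq c && (A == [set e in c])].

Definition num_cycles : nat := #|[set A : {set edge} | is_cycle A]|.

End Digraph.

Definition Gmulti (k n : nat) (G : digraph n) : bool :=
  [forall u, outdegree G u == k] &&
  [forall u, forall v, (u != v) ==> (G u v <= k - 1)].

(* The maximum is taken over the matrices with entries in {0, ..., k}, which
   loses nothing since outdegree k bounds every multiplicity by k. *)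
Definition F (k n : nat) : nat :=
  \max_(M : 'M['I_k.+1]_n | Gmulti k (map_mx (@nat_of_ord k.+1) M))
     num_cycles (map_mx (@nat_of_ord k.+1) M).

Lemma is_cycleP n (G : digraph n) (A : {set edge G}) :
  reflect (exists c, is_cycle_seq c /\ A = [set e in c]) (is_cycle A).
Proof.
apply: (iffP existsP) => [[r /existsP[c /andP[cc /eqP->]]]|[c [cc ->]]].
  by exists (val c).
have cn : size c < n.+1.
  have /and3P[_ _ uc] := cc.
  rewrite ltnS -(size_map (@source n G)) -(card_uniqP uc).
  by rewrite -[X in _ <= X]card_ord max_card.
exists (Ordinal cn); apply/existsP; exists (in_tuple c).
by rewrite cc eqxx.
Qed.

Lemma F_max k n (G : digraph n) : Gmulti k G -> num_cycles G <= F k n.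
Proof.
move=> GG.
have Gk u v : G u v < k.+1.
  have /andP[/forallP/(_ u)/eqP <- _] := GG.
  by rewrite ltnS /outdegree (bigD1 v) //= leq_addr.
pose M : 'M['I_k.+1]_n := (\matrix_(u, v) Ordinal (Gk u v))%R.
have MG : map_mx (@nat_of_ord k.+1) M = G by apply/matrixP => u v; rewrite !mxE.
rewrite -MG in GG *.
exact: (@leq_bigmax_cond _ (fun N => Gmulti k (map_mx (@nat_of_ord k.+1) N))
  (fun N => num_cycles (map_mx (@nat_of_ord k.+1) N)) M GG).
Qed.

Lemma F_attained k n : exists2 G : digraph n, Gmulti k G & F k n = num_cycles G.
Proof.
pose M0 : 'M['I_k.+1]_n := (\matrix_(u, v) if u == v then ord_max else ord0)%R.
have M0G : Gmulti k (map_mx (@nat_of_ord k.+1) M0).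
  apply/andP; split; apply/forallP => u.
    rewrite /outdegree (bigD1 u) //= !mxE eqxx big1 ?addn0 // => v vu.
    by rewrite !mxE eq_sym (negbTE vu).
  by apply/forallP => v; apply/implyP => uv; rewrite !mxE (negbTE uv).
have := @eq_bigmax_cond _ [pred M : 'M['I_k.+1]_n | Gmulti k (map_mx (@nat_of_ord k.+1) M)]
  (fun M => num_cycles (map_mx (@nat_of_ord k.+1) M)).
case=> [|M MG FE]; first by apply/card_gt0P; exists M0.
by exists (map_mx (@nat_of_ord k.+1) M).
Qed.

(* Convention: fib 0 = 0, fib 1 = 1. *)
Fixpoint fib (n : nat) : nat :=
  match n with
  | 0 => 0
  | 1 => 1
  | (p.+1 as q).+1 => fib q + fib p
  end.

Local Open Scope ring_scope.

Definition alpha (R : realType) (k : nat) : R :=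
  (k%:R - 1 + Num.sqrt ((k%:R - 1) ^+ 2 + 4)) / 2.

(* Main.v *)
(** Order the vertices and split the cycles according to their least vertex [t]:
    it suffices to bound by [O(alpha^m)] the number of paths to [t] through [m]
    given vertices, and the resulting bounds form a geometric series. The number
    of paths is an affine function of the out-edges of each single vertex, so
    every vertex may be assumed to have [K = k - 1] parallel (heavy) edges to one
    vertex and one (light) edge to another. Exploring the paths from their
    source, edges to visited vertices die; give a vertex the weight [alpha] when
    both its edges are alive, [h] when only the heavy one is, [l] when only the
    light one is and [1] otherwise. Then [alpha] times the product of the weights
    bounds the number of paths. At a source with targets [v] (heavy) and [w]
    (light) one needs [K p(v) + p(w) <= alpha^2 * (product of the other weights)],
    where [alpha^2 = K alpha + 1]: if nothing else reaches [v], the branch to [w]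
    wastes [v]; otherwise other vertices lose edges in the branch to [v]. For
    [K >= 2] this needs two reductions: vertices with only a light edge are
    bypassed, and a vertex [w] entered by few light edges only is handled by
    summing over the edge through which it is entered.

    For the lower bound, take the edges [i -> i+1] with multiplicity [K] and
    [i -> i+2] on a path, closed into a cycle by [K] edges from its last vertex to
    its first. *)
From mathcomp Require Import all_boot all_order all_algebra.
From mathcomp Require Import ring lra.
Require Import Defs.

Set Implicit Arguments.
Unset Strict Implicit.
Unset Printing Implicit Defensive.

Import Order.TTheory GRing.Theory Num.Theory.

(** * Counting paths *)

Section PathCount.
Variables (V : finType) (t : V).
Implicit Types (A B : V -> V -> nat) (S : {set V}) (u v w x y z : V).

(* [npaths A S u] counts the paths from [u] to the fixed vertex [t] all of whose
   inner vertices lie in [S], where [A y v] is the multiplicity of the edge from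
   [y] to [v]; the fuel [m] is the size of [S]. *)
Fixpoint npaths_rec m A S u : nat :=
  A u t + if m is m'.+1 then \sum_(v in S) A u v * npaths_rec m' A (S :\ v) v
          else 0.

Definition npaths A S u := npaths_rec #|S| A S u.

Lemma npathsE A S u :
  npaths A S u = A u t + \sum_(v in S) A u v * npaths A (S :\ v) v.
Proof.
rewrite /npaths; case E: #|S| => [|m] /=.
  by rewrite (cards0_eq E) big_set0.
by congr addn; apply: eq_bigr => v vS; have := cardsD1 v S; rewrite vS E => -[->].
Qed.

Lemma set_remove_ind (Q : {set V} -> Prop) :
  (forall S, (forall v, v \in S -> Q (S :\ v)) -> Q S) -> forall S, Q S.
Proof.
move=> step S; have [m] := ubnP #|S|; elim: m S => // m IH S leSm.
by apply: step => v vS; apply: IH; move: leSm; rewrite (cardsD1 v) vS.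
Qed.

Definition admissible S u := (u \notin S) && (t \notin u |: S).

Lemma admissible_step S u v : admissible S u -> v \in S -> admissible (S :\ v) v.
Proof.
rewrite /admissible !inE eqxx /= => /andP[_]; rewrite negb_or => /andP[_ tS] vS.
rewrite (negbTE tS) andbF orbF; apply/eqP => E; by rewrite E vS in tS.
Qed.

Lemma admissible_sub S S' u : admissible S u -> S' \subset S -> admissible S' u.
Proof.
rewrite /admissible !inE !negb_or => /and3P[uS tu tS] /subsetP sub.
by rewrite tu (contraNN (sub u) uS) (contraNN (sub t) tS).
Qed.

Lemma admissible_neq S u : admissible S u -> t != u.
Proof. by rewrite /admissible !inE negb_or => /and3P[]. Qed.

(** A path enters [z] at most once, so the ratio [d / c] on the edges into [z] is paid only once;
    paths that avoid [z] are covered by [c <= d]. After [z] has been visited, [mono] compares the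
    rest without any loss. *)
Lemma npaths_ratio c d z A B S u : admissible S u -> c <= d ->
  (forall y v, y \in u |: S -> v \in t |: S -> v != y -> v != z -> A y v <= B y v) ->
  (forall y, y \in u |: S -> z \in t |: S -> z != y -> c * A y z <= d * B y z) ->
  c * npaths A S u <= d * npaths B S u.
Proof.
move=> + cd; elim/set_remove_ind: S u => S IH u adm leAB leABz.
have mono S' u' : admissible S' u' -> z \notin t |: S' ->
    (u' |: S') \subset (u |: S) -> S' \subset S -> npaths A S' u' <= npaths B S' u'.
  elim/set_remove_ind: S' u' => S' IH' u' adm' zS' sub1 sub2.
  rewrite !npathsE; apply: leq_add.
    apply: leAB; rewrite ?setU11 //; first by apply: (subsetP sub1); rewrite setU11.
      exact: admissible_neq adm'.
    by move: zS'; rewrite !inE negb_or eq_sym => /andP[].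
  apply: leq_sum => v vS'; apply: leq_mul.
    apply: leAB; first by apply: (subsetP sub1); rewrite setU11.
    - by rewrite !inE (subsetP sub2 _ vS') orbT.
    - by apply: contraTneq vS' => ->; case/andP: adm'.
    - by apply: contraNneq zS' => <-; rewrite !inE vS' orbT.
  apply: IH' => //.
  - exact: admissible_step adm' vS'.
  - by apply: contraNN zS'; rewrite !inE => /orP[->|/andP[_ ->]] //; rewrite orbT.
  - by rewrite setD1K // (subset_trans _ sub1) // subsetUr.
  - by rewrite (subset_trans _ sub2) // subD1set.
have uu : u \in u |: S by rewrite !inE eqxx.
have tS : t \notin S by move: adm; rewrite /admissible !inE negb_or => /and3P[].
rewrite !npathsE !mulnDr !big_distrr /=; apply: leq_add.
  have [zt|zt] := eqVneq t z.
    by rewrite zt; apply: leABz; rewrite // -zt ?inE ?eqxx //; apply: admissible_neq adm.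
  by apply: leq_mul => //; apply: leAB; rewrite ?inE ?eqxx //; apply: admissible_neq adm.
apply: leq_sum => v vS; have vu : v != u.
  by apply: contraTneq vS => ->; case/andP: adm.
have sub : v |: S :\ v \subset u |: S by rewrite setD1K // subsetUr.
have [vz|vz] := eqVneq v z.
  rewrite !mulnA; apply: leq_mul.
    by rewrite vz; apply: leABz; rewrite // -vz ?inE ?vS ?orbT.
  apply: mono; rewrite ?subD1set //; first exact: admissible_step adm vS.
  by rewrite -vz !inE eqxx /= orbF; apply: contraNneq tS => <-.
rewrite mulnCA [leqRHS]mulnCA; apply: leq_mul.
  by apply: leAB; rewrite // !inE vS orbT.
apply: IH => //; first exact: admissible_step adm vS.
  move=> y v' yS v'S; apply: leAB; first exact: (subsetP sub).
  by move: v'S; rewrite !inE => /orP[->|/andP[_ ->]] //; rewrite orbT.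
move=> y yS zS; apply: leABz; first exact: (subsetP sub).
by move: zS; rewrite !inE => /orP[->|/andP[_ ->]] //; rewrite orbT.
Qed.

Lemma npaths_mono A B S u : admissible S u ->
  (forall y v, y \in u |: S -> v \in t |: S -> v != y -> A y v <= B y v) ->
  npaths A S u <= npaths B S u.
Proof.
move=> adm leAB; rewrite -[leqLHS]mul1n -[leqRHS]mul1n.
apply: (@npaths_ratio 1 1 u) => // [y v yS vS vy _|y yS uS uy]; first exact: leAB.
by rewrite !mul1n leAB.
Qed.

Lemma eq_npaths A B S u : admissible S u ->
  (forall y v, y \in u |: S -> v \in t |: S -> v != y -> A y v = B y v) ->
  npaths A S u = npaths B S u.
Proof.
by move=> adm eqAB; apply/eqP; rewrite eqn_leq; apply/andP; split;
  apply: npaths_mono => // y v *; rewrite eqAB.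
Qed.

Lemma setD1C (S : {set V}) x y : S :\ x :\ y = S :\ y :\ x.
Proof. by rewrite !setDDl setUC. Qed.

Lemma npaths_dead A S u x : admissible S u ->
  (forall v, v \in t |: S -> v != x -> A x v = 0) ->
  npaths A S u = npaths A (S :\ x) u.
Proof.
elim/set_remove_ind: S u => S IH u adm dead.
have [xS|xS] := boolP (x \in S); last first.
  by rewrite (setDidPl _) // disjoint_sym disjoints1.
have tx : t != x by apply: admissible_neq (admissible_step adm xS).
rewrite !npathsE (bigD1 x) //=.
have -> : npaths A (S :\ x) x = 0.
  rewrite npathsE dead ?setU11 // big1 // => v; rewrite !inE => /andP[vx vS].
  by rewrite dead // !inE vS orbT.
rewrite muln0 add0n; congr addn.
rewrite (eq_bigl (fun v => v \in S :\ x)) => [|v]; last by rewrite !inE andbC.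
apply: eq_bigr => v; rewrite inE => /andP[vx vS]; congr muln.
rewrite setD1C IH //; first exact: admissible_step adm vS.
move=> v' v'S v'x; apply: dead => //.
by move: v'S; rewrite !inE => /orP[->|/andP[_ ->]] //; rewrite orbT.
Qed.


(** The value 1 at [t] stands for the path that has arrived, so that edges to [t] and edges into [S]
    can be summed alike. *)
Definition tail_paths A S v := if v == t then 1 else npaths A (S :\ v) v.

Lemma npaths_tailE A S u : t \notin S ->
  npaths A S u = \sum_(v in t |: S) A u v * tail_paths A S v.
Proof.
move=> tS; rewrite npathsE big_setU1 //= /tail_paths eqxx muln1; congr addn.
by apply: eq_bigr => v vS; case: eqP => // vt; rewrite -vt vS in tS.
Qed.

Lemma tail_paths_neq A S v : t \notin S -> v \in S -> tail_paths A S v = npaths A (S :\ v) v.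
Proof. by move=> tS vS; rewrite /tail_paths; case: eqP => // vt; rewrite -vt vS in tS. Qed.

Lemma setU1D1 S x : t != x -> (t |: S) :\ x = t |: S :\ x.
Proof.
move=> tx; apply/setP => v; rewrite !inE.
by have [->|] := eqVneq v x; rewrite // eq_sym (negbTE tx).
Qed.

(** A path through [x] has to go on to [z], so each pair of edges from [y] to [x] and from [x] to
    [z] can be contracted to one edge from [y] to [z]. *)
Lemma npaths_bypass A B S u x z : admissible S u -> x \in S -> z \in t |: S ->
  z != x -> (forall v, v \in t |: S -> v != x -> v != z -> A x v = 0) ->
  (forall y v, y \in u |: S -> y != x -> v \in t |: S -> v != y -> v != x ->
     B y v = A y v + (v == z) * (A y x * A x z)) ->
  npaths A S u = npaths B (S :\ x) u.
Proof.
elim/set_remove_ind: S u => S IH u adm xS zS zx deadx AB.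
have uS : u \notin S by case/andP: adm.
have tS : t \notin S by move: adm; rewrite /admissible !inE negb_or => /and3P[].
have tx : t != x by apply: contraNneq tS => ->.
have uu : u \in u |: S by rewrite setU11.
have ux : u != x by apply: contraNneq uS => ->.
have tu : t != u by apply: admissible_neq adm.
have subS v S' : S' \subset S -> v \in t |: S' -> v \in t |: S.
  by move=> /setUS/subsetP; apply.
have adm' v S' : v \in S -> v \notin S' -> S' \subset S -> admissible S' v.
  move=> vS vS' sub; rewrite /admissible vS' !inE negb_or (contraNN (subsetP sub t) tS).
  by rewrite andbT; apply: contraNneq tS => ->.
have tailz : tail_paths A (S :\ x) z = tail_paths B (S :\ x) z.
  rewrite /tail_paths; case: (eqVneq z t) zS => // zt; rewrite !inE (negbTE zt) /= => zS.
  have sub : S :\ x :\ z \subset S by rewrite setDDl subsetDl.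
  apply: eq_npaths; first by apply: adm' => //; rewrite !inE eqxx.
  move=> y v yS vS vy; rewrite AB //.
  - suff -> : v == z = false by rewrite addn0.
    apply: contraTF vS => /eqP ->; rewrite !inE eqxx orbF //.
  - by move: yS; rewrite !inE => /orP[/eqP->|/and3P[_ _ ->]]; rewrite ?zS orbT.
  - by apply: contraTneq yS => ->; rewrite !inE eqxx andbF orbF eq_sym.
  - exact: subS vS.
  - by apply: contraTneq vS => ->; rewrite !inE eqxx andbF orbF eq_sym.
(* Once [z] is visited, [x] is a dead end. *)
have tailSz : tail_paths A S z = tail_paths B (S :\ x) z.
  rewrite -tailz /tail_paths; case: (eqVneq z t) zS => // zt; rewrite !inE (negbTE zt) /= => zS.
  rewrite setD1C; apply: npaths_dead.
    by apply: adm'; rewrite // ?inE ?eqxx // subD1set.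
  move=> v vS vx; apply: deadx => //; first by apply: subS vS; rewrite subD1set.
  by apply: contraTneq vS => ->; rewrite !inE eqxx orbF.
have tailx : tail_paths A S x = A x z * tail_paths B (S :\ x) z.
  rewrite tail_paths_neq // npaths_tailE ?inE ?(negbTE tS) ?andbF //.
  rewrite (bigD1 z) /=; last by rewrite -setU1D1 // !inE zx; move: zS; rewrite !inE.
  rewrite tailz big1 ?addn0 // => v /andP[]; rewrite -setU1D1 // !inE => /andP[vx vS] vz.
  by rewrite deadx ?inE.
have tailv v : v \in t |: S -> v != x -> tail_paths A S v = tail_paths B (S :\ x) v.
  move=> vS vx; have [->//|vz] := eqVneq v z.
  rewrite /tail_paths; case: (eqVneq v t) vS => // vt; rewrite !inE (negbTE vt) /= => vS.
  rewrite setD1C; apply: IH => //.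
  - exact: admissible_step adm vS.
  - by rewrite !inE eq_sym vx.
  - by rewrite !inE [z == v]eq_sym vz /=; move: zS; rewrite !inE.
  - by move=> v' v'S *; apply: deadx => //; apply: subS v'S; rewrite subD1set.
  move=> y v' yS yx v'S v'y v'x; apply: AB => //.
    by move: yS; rewrite setD1K // !inE => ->; rewrite orbT.
  by apply: subS v'S; rewrite subD1set.
rewrite npaths_tailE // npaths_tailE ?inE ?(negbTE tS) ?andbF // -setU1D1 //.
rewrite (big_setD1 x) ?inE ?xS ?orbT //=.
have zT : z \in (t |: S) :\ x by rewrite in_setD1 zx.
rewrite [in RHS](big_setD1 z) //= [in LHS](big_setD1 z) //= tailx tailSz addnA.
congr addn; last first.
  apply: eq_bigr => v; rewrite !in_setD1 => /and3P[vz vx vS].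
  rewrite tailv // AB //; first by rewrite (negbTE vz) addn0.
  by move: vS; rewrite !inE => /orP[/eqP->//|]; apply: contraTneq => ->.
have zu : z != u.
  by move: zS; rewrite !inE => /orP[/eqP->//|]; apply: contraTneq => ->.
by rewrite AB // eqxx mul1n mulnDl addnC mulnA.
Qed.

(* Splits the paths through [w] by the vertex [y] preceding [w]; contracting the
   edge from [y] to [w] gives [y] the out-edges of [w]. *)
Lemma npaths_in_expansion A (Aw : V -> V -> V -> nat) S u w : admissible S u -> w \in S ->
  (forall y y' v, Aw y y' v = A (if y' == y then w else y') v) ->
  npaths A S u <= npaths A (S :\ w) u +
    \sum_(y in u |: S :\ w) A y w * npaths (Aw y) (S :\ w) u.
Proof.
move=> + + AwE; elim/set_remove_ind: S u => S IH u adm wS.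
have uS : u \notin S by case/andP: adm.
have tS : t \notin S by move: adm; rewrite /admissible !inE negb_or => /and3P[].
have uSw : u \notin S :\ w by rewrite inE (negbTE uS) andbF.
rewrite big_setU1 //= npathsE (bigD1 w) //=.
have -> : npaths (Aw u) (S :\ w) u = npaths A (S :\ w) w.
  rewrite !npathsE AwE eqxx; congr addn; apply: eq_bigr => v vSw; rewrite AwE eqxx; congr muln.
  apply: eq_npaths.
    by apply: (@admissible_step _ u) => //; apply: admissible_sub adm _; rewrite subD1set.
  move=> y v' yS v'S v'y; rewrite AwE; case: eqP => // yu; move: yS; rewrite yu setD1K //.
  by rewrite (negbTE uSw).
rewrite addnCA [leqRHS]addnCA leq_add2l.
have step v : v \in S :\ w -> A u v * npaths A (S :\ v) v <=
    A u v * npaths A (S :\ w :\ v) v +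
    \sum_(y in S :\ w) A y w * (A u v * npaths (Aw y) (S :\ w :\ v) v).
  rewrite !inE => /andP[vw vS].
  rewrite (eq_bigr (fun y => A u v * (A y w * npaths (Aw y) (S :\ w :\ v) v))); last first.
    by move=> y _; rewrite mulnCA.
  rewrite -big_distrr -mulnDr leq_mul2l; apply/orP; right => /=.
  apply: leq_trans (IH v vS v (admissible_step adm vS) _) _; first by rewrite !inE eq_sym vw.
  by rewrite setD1C setD1K // !inE vw.
apply: leq_trans (_ : A u t + \sum_(v in S :\ w) (A u v * npaths A (S :\ w :\ v) v +
    \sum_(y in S :\ w) A y w * (A u v * npaths (Aw y) (S :\ w :\ v) v)) <= _).
  rewrite leq_add2l (eq_bigl (fun v => v \in S :\ w)) => [|v]; last by rewrite !inE andbC.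
  exact: leq_sum.
rewrite big_split /= addnA -npathsE leq_add2l exchange_big /=.
apply: leq_sum => y yS; rewrite -big_distrr leq_mul2l; apply/orP; right => /=.
have uy : u != y by apply: contraTneq yS => <-.
rewrite npathsE; apply: leq_trans (leq_addl _ _).
by apply: leq_sum => v _; rewrite AwE (negbTE uy).
Qed.

(** A path leaves [y] at most once, hence uses at most one edge of the row of [y]; the coefficients
    [c] and [f] depend on the other rows only. *)
Lemma npaths_row_linear A S u y : admissible S u ->
  exists c f, forall B, (forall y' v, y' != y -> B y' v = A y' v) ->
    npaths B S u = c + \sum_(v in (t |: S) :\ y) B y v * f v.
Proof.
elim/set_remove_ind: S u => S IH u adm.
have tS : t \notin S by move: adm; rewrite /admissible !inE negb_or => /and3P[].
have uS : u \notin S by case/andP: adm.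
have tu := admissible_neq adm.
have [uy|uy] := eqVneq u y.
  subst y; exists 0, (tail_paths A S) => B BA; rewrite add0n npaths_tailE //.
  have -> : (t |: S) :\ u = t |: S.
    by apply/setDidPl; rewrite disjoint_sym disjoints1 !inE negb_or eq_sym tu.
  apply: eq_bigr => v; rewrite !inE /tail_paths => vS; case: (eqVneq v t) vS => //= vt vS.
  congr muln; apply: eq_npaths => [|y' v' y'S v'S v'y']; first exact: admissible_step adm vS.
  by apply: BA; apply: contraTneq y'S => ->; rewrite setD1K.
have H v : exists cf : nat * (V -> nat), v \in S ->
    forall B, (forall y' v, y' != y -> B y' v = A y' v) ->
    npaths B (S :\ v) v = cf.1 + \sum_(v' in (t |: S) :\ y) B y v' * cf.2 v'.
  have [vS|vS] := boolP (v \in S); last by exists (0, fun=> 0) => vS'; case/negP: vS.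
  have [c [f E]] := IH v vS v (admissible_step adm vS).
  (* The zero coefficient at the removed vertex [v] lets all the [v] share one index set. *)
  exists (c, fun v' => if v' == v then 0 else f v') => _ B BA; rewrite E //=; congr addn.
  have tv : t != v by apply: contraNneq tS => ->.
  rewrite -setU1D1 // [in RHS](bigID (fun v' => v' == v)) /= [X in _ = X + _]big1 ?add0n.
    apply: eq_big => v'; first by rewrite !inE [(_ != v) && _]andbC andbA.
    by rewrite !inE => /and3P[_ /negbTE-> _].
  by move=> v' /andP[_ ->]; rewrite muln0.
have [cf cfE] := fin_all_exists H.
exists (A u t + \sum_(v in S) A u v * (cf v).1).
exists (fun v' => \sum_(v in S) A u v * (cf v).2 v') => B BA.
rewrite npathsE BA // -addnA; congr addn.
rewrite [X in _ = _ + X](eq_bigr (fun v' =>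
   \sum_(v in S) A u v * (B y v' * (cf v).2 v'))); last first.
  by move=> v' _; rewrite big_distrr; apply: eq_bigr => v _; rewrite mulnCA.
rewrite exchange_big -big_split; apply: eq_bigr => v vS.
by rewrite BA // (cfE v vS B BA) /= mulnDr big_distrr.
Qed.

End PathCount.

(** * Reduction to one heavy and one light edge per vertex *)

Section HeavyLight.
Variables (V : finType) (t : V) (K : nat).
Implicit Types (A B : V -> V -> nat) (a b : V -> V) (S D : {set V}) (u v w x y z : V).

(* The digraph in which [y] has [K] parallel edges to [a y] and one edge to
   [b y]; a self-loop encodes the absence of an edge. *)
Definition heavy_light a b y v : nat := K * (a y == v) + (b y == v).

Lemma sum_heavy_light D f v w :
  \sum_(x in D) (K * (v == x) + (w == x)) * f x
    = K * ((v \in D) * f v) + (w \in D) * f w.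
Proof.
have H z : \sum_(x in D) (z == x) * f x = (z \in D) * f z.
  have [zD|zD] := boolP (z \in D).
    rewrite (big_setD1 z) //= eqxx big1 ?addn0 // => x; rewrite !inE eq_sym.
    by move=> /andP[/negbTE->].
  by rewrite big1 // => x xD; case: eqP zD => // ->; rewrite xD.
rewrite -!H big_distrr -big_split; apply: eq_bigr => x _.
by rewrite mulnDl -mulnA.
Qed.

(** A linear form with coefficients [f], under a cap [K] on each entry and [K.+1] on the total, is
    largest when [K] goes to the largest coefficient and the remaining unit to the second
    largest. *)
Lemma heavy_light_row D y (r f : V -> nat) : t \in D -> y \notin D ->
  (forall v, v \in D -> r v <= K) -> \sum_(v in D) r v <= K.+1 ->
  exists v w, v != w /\
    \sum_(x in D) r x * f x <= \sum_(x in D) (K * (v == x) + (w == x)) * f x.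
Proof.
move=> tD yD rK rsum.
have [v vD vmax] := @arg_maxnP V t (fun x => x \in D) f tD.
have rv := rK v vD.
have [D0|[w0 w0D]] := set_0Vmem (D :\ v).
  (* There is no second target; as [y] is outside [D], the light edge to [y] counts for nothing. *)
  exists v, y; split; first by apply: contraNneq yD => <-.
  rewrite sum_heavy_light vD (negbTE yD) mul0n addn0 mul1n.
  by rewrite (big_setD1 v) //= D0 big_set0 addn0 leq_mul2r rv orbT.
have [w /setD1P[wv wD] wmax] := @arg_maxnP V w0 (fun x => x \in D :\ v) f w0D.
exists v, w; split; first by rewrite eq_sym.
rewrite sum_heavy_light vD wD !mul1n.
have fwv : f w <= f v by apply: vmax.
rewrite (big_setD1 v) //=.
apply: (@leq_trans (r v * f v + (K.+1 - r v) * f w)).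
  rewrite leq_add2l; apply: (@leq_trans (\sum_(x in D :\ v) r x * f w)).
    by apply: leq_sum => x xD; rewrite leq_mul2l; apply/orP; right; apply: wmax.
  rewrite -big_distrl leq_mul2r; apply/orP; right.
  by move: rsum; rewrite (big_setD1 v) //= leq_subRL // (leq_trans rv).
rewrite subSn // mulSn addnCA addnC leq_add2r.
apply: (@leq_trans (r v * f v + (K - r v) * f v)).
  by rewrite leq_add2l leq_mul2l fwv orbT.
by rewrite -mulnDl subnKC.
Qed.

(** The rows are replaced one at a time: with the others fixed, the count is affine in the current
    row, and [heavy_light_row] finds a maximizing row of the required shape. *)
Lemma npaths_heavy_light A S u : admissible t S u ->
  (forall y, y \in u |: S -> (forall v, v \in (t |: S) :\ y -> A y v <= K) /\
     \sum_(v in (t |: S) :\ y) A y v <= K.+1) ->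
  exists a b, (forall y, y \in u |: S -> a y != b y) /\
    npaths t A S u <= npaths t (heavy_light a b) S u.
Proof.
move=> adm rowA.
have tuS : t \notin u |: S by case/andP: adm.
suff [a [b [wf le]]] : exists a b, (forall y, y \in u |: S -> a y != b y) /\
    npaths t A S u <=
      npaths t (fun y => if y \in enum (u |: S) then heavy_light a b y else A y) S u.
  exists a, b; split => //; apply: leq_trans le _.
  by apply: npaths_mono => // y v yS vS vy; rewrite mem_enum yS.
have : {subset enum (u |: S) <= u |: S} by move=> y; rewrite mem_enum.
suff H (s : seq V) : {subset s <= u |: S} -> exists a b, (forall y, y \in s -> a y != b y) /\
    npaths t A S u <= npaths t (fun y => if y \in s then heavy_light a b y else A y) S u.
  by move=> /H[a [b [wf le]]]; exists a, b; split => // y yS; apply: wf; rewrite mem_enum.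
elim: s => [|y s IH] sub.
  by exists id, id; split => //; apply: npaths_mono.
have /IH[a [b [wf le]]] : {subset s <= u |: S}.
  by move=> z zs; apply: sub; rewrite inE zs orbT.
have yS : y \in u |: S by apply: sub; rewrite mem_head.
have [ys|ys] := boolP (y \in s).
  exists a, b; split=> [z|]; first by rewrite inE => /orP[/eqP->|]; apply: wf.
  apply: leq_trans le _; apply: npaths_mono => // z v _ _ _; rewrite inE.
  by case: (eqVneq z y) => [->|//] /=; rewrite ys.
set B := fun y => if y \in s then heavy_light a b y else A y in le.
have [c [f E]] := @npaths_row_linear V t B S u y adm.
have [rK rsum] := rowA y yS.
have [||||v [w [vw leB]]] := @heavy_light_row ((t |: S) :\ y) y (B y) f.
- by rewrite !inE eqxx andbT; apply: contraNneq tuS => ->.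
- by rewrite !inE eqxx.
- by move=> v vS; rewrite /B (negbTE ys) rK.
- by rewrite /B (negbTE ys).
exists (fun z => if z == y then v else a z), (fun z => if z == y then w else b z).
split=> [z|]; first by rewrite inE; case: eqP => // _; apply: wf.
apply: leq_trans le _; rewrite E // E ?leq_add2l => [|z x zy].
  by rewrite mem_head /heavy_light eqxx.
by rewrite inE (negbTE zy) /B /=; case: ifP => // _; rewrite /heavy_light (negbTE zy).
Qed.

End HeavyLight.

(** * The potential *)

Section Potential.
Local Open Scope ring_scope.
Variables (R : realFieldType) (V : finType) (t : V) (K : nat) (al h l : R).
Hypotheses (l1 : 1 <= l) (lh : l <= h) (hal : h <= al).
Implicit Types (a b : V -> V) (S T : {set V}) (u v w x y z : V).

Let h1 : 1 <= h. Proof. exact: le_trans lh. Qed.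
Let al1 : 1 <= al. Proof. exact: le_trans hal. Qed.

Lemma prod_le_expr (T J : {set V}) (c : R) (f g : V -> R) : J \subset T -> 0 <= c ->
  (forall y, y \in T -> 0 <= f y <= g y) -> (forall y, y \in J -> f y <= c * g y) ->
  \prod_(y in T) f y <= c ^+ #|J| * \prod_(y in T) g y.
Proof.
move=> JT c0 fg fJ.
have -> : c ^+ #|J| = \prod_(y in T) (if y \in J then c else 1).
  rewrite -big_mkcondr /= -prodr_const; apply: eq_bigl => y.
  by rewrite andbC; case yJ: (y \in J) => //=; rewrite (subsetP JT).
rewrite -big_split; apply: ler_prod => y yT /=.
have /andP[-> ?] := fg y yT; case: ifP => [/fJ //|_]; by rewrite mul1r.
Qed.

Definition alive S y v := (v \in t |: S) && (v != y).

Definition edge_weight (ha hb : bool) : R :=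
  if ha then (if hb then al else h) else (if hb then l else 1).

Definition weight S a b y := edge_weight (alive S y (a y)) (alive S y (b y)).

Definition potential S T a b := \prod_(y in T) weight S a b y.

Definition well_formed S u a b := forall y, y \in u |: S -> a y != b y.

Definition npaths_hl a b S u := npaths t (heavy_light K a b) S u.

Definition bounded S a b u :=
  (npaths_hl a b S u)%:R <= al * potential S (u |: S) a b.

Lemma edge_weight_mono (ha hb ha' hb' : bool) : (ha -> ha') -> (hb -> hb') ->
  edge_weight ha hb <= edge_weight ha' hb'.
Proof.
rewrite /edge_weight; case: ha => [/(_ isT)->|_]; case: hb => [/(_ isT)->|_];
  case: ha'; case: hb' => //; by do ?[apply: le_trans lh | apply: le_trans hal].
Qed.

Lemma edge_weight_ge1 ha hb : 1 <= edge_weight ha hb.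
Proof. by rewrite /edge_weight; case: ha; case: hb. Qed.

Lemma weight_ge1 S a b y : 1 <= weight S a b y. Proof. exact: edge_weight_ge1. Qed.
Lemma weight_gt0 S a b y : 0 < weight S a b y. Proof. exact: lt_le_trans (weight_ge1 _ _ _ _). Qed.

Lemma alive_sub S' S y v : S' \subset S -> alive S' y v -> alive S y v.
Proof. by rewrite /alive => /(setUS [set t])/subsetP s /andP[/s-> ->]. Qed.

Lemma alive_remove S x y v : alive S y v -> v != x -> alive (S :\ x) y v.
Proof. by rewrite /alive !inE => /andP[/orP[->|->] ->] // ->; rewrite orbT. Qed.

Lemma alive_removed S y v : t != v -> alive (S :\ v) y v = false.
Proof. by rewrite /alive !inE eqxx orbF eq_sym => /negbTE->. Qed.

Lemma weight_sub S' S a b y : S' \subset S -> weight S' a b y <= weight S a b y.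
Proof. by move=> sub; apply: edge_weight_mono; apply: alive_sub. Qed.

Lemma potential_ge1 S T a b : 1 <= potential S T a b.
Proof.
by rewrite /potential; elim/big_rec: _ => // y p _ p1; rewrite -[leLHS]mulr1 ler_pM ?weight_ge1.
Qed.

Lemma potential_gt0 S T a b : 0 < potential S T a b.
Proof. exact: lt_le_trans (potential_ge1 _ _ _ _). Qed.

Lemma potential_expr S' S T (J : {set V}) (c : R) a b : S' \subset S -> J \subset T -> 0 <= c ->
  (forall y, y \in J -> weight S' a b y <= c * weight S a b y) ->
  potential S' T a b <= c ^+ #|J| * potential S T a b.
Proof.
move=> sub JT c0 cJ; apply: prod_le_expr => // y _.
by rewrite weight_sub // ltW ?weight_gt0.
Qed.

Lemma potential_drop S' S T (c : R) a b x : S' \subset S -> x \in T -> 0 <= c ->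
  weight S' a b x <= c * weight S a b x ->
  potential S' T a b <= c * potential S T a b.
Proof.
move=> sub xT c0 cx; rewrite -[c]expr1 -[1%N](cards1 x); apply: potential_expr => //.
  by rewrite sub1set.
by move=> y /set1P->.
Qed.

Lemma potential_sub S' S T a b : S' \subset S -> potential S' T a b <= potential S T a b.
Proof.
move=> sub; rewrite -[leRHS]mul1r -[1](expr0 1) -(@cards0 V).
by apply: potential_expr; rewrite // ?sub0set // => y; rewrite inE.
Qed.

Lemma potentialD1 S T a b x : x \in T ->
  potential S T a b = weight S a b x * potential S (T :\ x) a b.
Proof. by move=> xT; rewrite /potential (big_setD1 x). Qed.

Lemma potentialU1 S u a b : u \notin S ->
  potential S (u |: S) a b = weight S a b u * potential S S a b.
Proof. by move=> uS; rewrite (@potentialD1 _ _ _ _ u) ?setU11 // setU1K. Qed.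

Section Step.
Variables (S : {set V}) (a b : V -> V) (u : V).
Hypotheses (adm : admissible t S u) (wf : well_formed S u a b).
Hypothesis IH : forall S', (#|S'| < #|S|)%N -> forall a b u,
  admissible t S' u -> well_formed S' u a b -> bounded S' a b u.

Lemma card_remove S' x : S' \subset S -> x \in S -> (#|S' :\ x| < #|S|)%N.
Proof.
move=> sub xS; apply: proper_card; apply/properP; split.
  by apply: subset_trans sub; rewrite subD1set.
by exists x => //; rewrite !inE eqxx.
Qed.

Lemma u_notin : u \notin S. Proof. by case/andP: adm. Qed.
Lemma t_notin : t \notin S. Proof. by move: adm; rewrite /admissible !inE negb_or => /and3P[]. Qed.
Lemma t_neq x : x \in S -> t != x. Proof. by apply: contraTneq => <-; apply: t_notin. Qed.
Lemma u_neq x : x \in S -> u != x. Proof. by apply: contraTneq => <-; apply: u_notin. Qed.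

Lemma admissible_in S' x : S' \subset S -> x \in S -> admissible t (S' :\ x) x.
Proof.
move=> sub xS; rewrite /admissible !inE eqxx /= negb_or negb_and t_neq //=.
exact: contraNN (subsetP sub t) t_notin.
Qed.

Lemma well_formed_sub S' x : S' \subset S -> x \in u |: S -> well_formed S' x a b.
Proof.
move=> sub xS y; rewrite inE => /orP[/set1P->|yS]; first exact: wf.
by apply: wf; rewrite !inE (subsetP sub) ?orbT.
Qed.

Lemma bounded_in S' x : S' \subset S -> x \in S ->
  (npaths_hl a b (S' :\ x) x)%:R <= al * potential (S' :\ x) (x |: S') a b.
Proof.
move=> sub xS; have -> : x |: S' = x |: S' :\ x.
  by apply/setP => y; rewrite !inE; case: eqP.
apply: IH; [exact: card_remove|exact: admissible_in|].
by apply: well_formed_sub; rewrite ?inE ?xS ?orbT // (subset_trans _ sub) // subD1set.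
Qed.

Lemma bounded_in1 x : x \in S ->
  (npaths_hl a b (S :\ x) x)%:R <= al * potential (S :\ x) S a b.
Proof. by move=> xS; have := bounded_in (subxx S) xS; rewrite setUC (setUidPl _) // sub1set. Qed.

(** The value 0 for dead targets makes [npaths_branch] valid in all cases. *)
Definition branch v : nat := if v \in t |: S then tail_paths t (heavy_light K a b) S v else 0.

Lemma npaths_branch : npaths_hl a b S u = (K * branch (a u) + branch (b u))%N.
Proof.
rewrite /npaths_hl npaths_tailE ?t_notin // /heavy_light sum_heavy_light /branch.
by case: ifP; case: ifP; rewrite ?mul0n ?mul1n ?muln0.
Qed.

Lemma branch_in v : v \in S -> branch v = npaths_hl a b (S :\ v) v.
Proof. by move=> vS; rewrite /branch !inE vS orbT tail_paths_neq // t_notin. Qed.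

Lemma branch_t : branch t = 1%N.
Proof. by rewrite /branch setU11 /tail_paths eqxx. Qed.

Lemma alive_u v : alive S u v = (v \in t |: S).
Proof.
rewrite /alive andbC; case vS: (v \in _); rewrite ?andbF ?andbT //.
apply/eqP => E; move: vS.
by rewrite E !inE (negbTE u_notin) orbF eq_sym (negbTE (admissible_neq adm)).
Qed.

Lemma branch_out v : ~~ alive S u v -> branch v = 0%N.
Proof. by rewrite alive_u /branch => /negbTE->. Qed.

Lemma branch_le v : (branch v)%:R <= al * potential S S a b.
Proof.
have Phi1 := potential_ge1 S S a b.
have ge1 : 1 <= al * potential S S a b by rewrite -[leLHS]mulr1 ler_pM.
rewrite /branch; case: ifP => [|_]; last by apply: le_trans ge1.
rewrite inE => /orP[/set1P->|vS]; first by rewrite /tail_paths eqxx.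
rewrite tail_paths_neq ?t_notin //; apply: le_trans (bounded_in1 vS) _.
by rewrite ler_pM2l ?potential_sub ?subD1set // (lt_le_trans _ al1).
Qed.

Lemma npaths_single c : (0 < K)%N -> ~~ (alive S u (a u) && alive S u (b u)) ->
  K%:R <= c -> (npaths_hl a b S u)%:R <= c * al * potential S S a b.
Proof.
move=> K0 nab Kc.
have K1 : 1 <= K%:R :> R by rewrite ler1n.
have P0 : 0 <= al * potential S S a b by rewrite mulr_ge0 ?(le_trans _ al1) ?ltW ?potential_gt0.
rewrite npaths_branch -mulrA.
case: (boolP (alive S u (b u))) nab => [bu|/branch_out-> _].
  rewrite andbT => /branch_out->; rewrite muln0 add0n; apply: le_trans (branch_le _) _.
  by rewrite ler_peMl // (le_trans K1).
rewrite addn0 natrM; apply: ler_pM; rewrite ?branch_le //.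
Qed.

(** No edge enters [w], so only the first term of [npaths_in_expansion] survives. *)
Lemma npaths_unreachable w : w \in S ->
  (forall y, y \in u |: S -> y != w -> a y != w /\ b y != w) ->
  (npaths_hl a b S u <= npaths_hl a b (S :\ w) u)%N.
Proof.
move=> wS nopred; rewrite /npaths_hl.
pose A := heavy_light K a b.
pose Aw y y' v := A (if y' == y then w else y') v.
apply: leq_trans (@npaths_in_expansion V t A Aw S u w adm wS _) _ => //.
rewrite big1 ?addn0 // => y.
rewrite !inE => yS; have [||/negbTE aw /negbTE bw] := nopred y.
- by move: yS; rewrite !inE => /orP[->|/andP[_ ->]] //; rewrite orbT.
- by move: yS => /orP[/eqP->|/andP[]] //; apply: u_neq.
- by rewrite /A /heavy_light aw bw muln0.
Qed.

(** Reduces the induction step to the case of two targets in [S]. The bound [K <= al * (al - 1)]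
    serves a heavy edge to [t], which carries just [K] paths, and [K <= h] serves a dead light edge;
    a light edge to [t] is paid by the 1 in [K * al + 1]. *)
Lemma bounded_step : al ^+ 2 = K%:R * al + 1 -> (0 < K)%N -> K%:R <= h ->
    K%:R <= al * (al - 1) ->
  (a u \in S -> b u \in S ->
    K%:R * (npaths_hl a b (S :\ a u) (a u))%:R + (npaths_hl a b (S :\ b u) (b u))%:R
      <= al ^+ 2 * potential S S a b) ->
  bounded S a b u.
Proof.
move=> al2 K0 Kh Kal core; rewrite /bounded potentialU1 ?u_notin //.
set P := potential S S a b in core *.
have P1 : 1 <= P := potential_ge1 _ _ _ _.
have P0 : 0 < P by apply: lt_le_trans P1.
have al0 : 0 < al by apply: lt_le_trans al1.
have K1 : 1 <= K%:R :> R by rewrite ler1n.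
rewrite /weight; case aa: (alive S u (a u)); case bb: (alive S u (b u)) => /=; last 1 first.
- by rewrite npaths_branch !branch_out ?aa ?bb // muln0 addn0 mul1r mulr_ge0 // ltW.
- move: aa bb; rewrite !alive_u !inE npaths_branch natrD natrM.
  have auS : a u != b u by apply: wf; rewrite setU11.
  move=> /orP[/eqP ut|aS] /orP[/eqP bt|bS].
  + by rewrite ut bt eqxx in auS.
  + rewrite ut branch_t mulr1 mulrA -expr2.
    apply: le_trans (_ : al * (al - 1) * P + al * P <= _).
      apply: lerD; last exact: branch_le.
      by apply: le_trans Kal _; rewrite ler_peMr // mulr_ge0 ?subr_ge0 // ltW.
    by rewrite -mulrDl mulrBr mulr1 subrK -expr2.
  + rewrite bt branch_t mulrA -expr2 al2 mulrDl mul1r lerD // -mulrA ler_pM2l ?branch_le //.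
    exact: lt_le_trans K1.
  + by rewrite !branch_in // mulrA -expr2 core.
- rewrite mulrA [al * h]mulrC; apply: npaths_single => //; by rewrite aa bb.
- rewrite npaths_branch branch_out ?aa // muln0 add0n /edge_weight.
  apply: le_trans (branch_le _) _; rewrite -/P ler_pM2l // ler_peMl //; exact: ltW.
Qed.

End Step.
End Potential.

(** * The bound for [K = 1] *)

Section KOne.
Local Open Scope ring_scope.
Variables (R : realFieldType) (V : finType) (t : V) (al m : R).
Hypotheses (m1 : 1 <= m) (mm : m ^+ 2 = al) (al2 : al ^+ 2 = al + 1).
Implicit Types (a b : V -> V) (S T : {set V}) (u v w x y z : V).
Local Notation bd := (bounded t 1 al m m).
Local Notation P := (npaths_hl t 1).
Local Notation wt := (weight t al m m).
Local Notation pot := (potential t al m m).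

Let mal : m <= al. Proof. by rewrite -mm expr2 ler_peMr // (le_trans ler01). Qed.
Let al1 : 1 <= al. Proof. exact: le_trans m1 mal. Qed.
Let al0 : 0 < al. Proof. exact: lt_le_trans ltr01 al1. Qed.
Let mgt0 : 0 < m. Proof. exact: lt_le_trans ltr01 m1. Qed.

(** This is what makes room for two branches that each lose a factor [m]. *)
Let alm2 : 2 <= al * m.
Proof.
rewrite -ler_sqr ?nnegrE ?mulr_ge0 // ?ltW // exprMn mm al2.
have al32 : 3 / 2 <= al by rewrite leNgt; apply/negP => ?; have := al2; have := al1; nra.
have := al2; nra.
Qed.

Section Step.
Variables (S : {set V}) (a b : V -> V) (u : V).
Hypotheses (adm : admissible t S u) (wf : well_formed S u a b).
Hypothesis IH : forall S', (#|S'| < #|S|)%N -> forall a b u,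
  admissible t S' u -> well_formed S' u a b -> bd S' a b u.

(** For [K = 1] the two edges play the same role, so [h = l = m]; as [m ^+ 2 = al], each lost edge
    costs exactly the factor [m]. *)
Lemma weight_lose_one v x : v \in S -> x != v -> x \in S -> a x = v \/ b x = v ->
  wt (S :\ v) a b x <= m^-1 * wt S a b x.
Proof.
move=> vS xv xS pred; have tv : t != v := t_neq adm vS.
have av : alive t S x v by rewrite /alive !inE vS orbT eq_sym xv.
have ab : a x != b x by apply: wf; rewrite !inE xS orbT.
have mVm : m^-1 * m = 1 by rewrite mulVf ?gt_eqF.
have mVal : m^-1 * al = m by rewrite -mm expr2 mulKf ?gt_eqF.
case: pred => E; move: ab; rewrite /weight E => ab;
  rewrite (alive_removed _ _ tv) av /edge_weight /=.
- case: ifP => [bb|_]; first by rewrite (alive_sub _ bb) ?subD1set // mVal.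
  by case: ifP; rewrite ?mVal ?mVm.
- case: ifP => [aa|_]; first by rewrite (alive_sub _ aa) ?subD1set // mVal.
  by case: ifP; rewrite ?mVal ?mVm.
Qed.

(** The branch to [w] wastes [v], hence is at most [al * F], where [F] leaves out the weight of [v].
    With two live edges at [v] the total is at most [al * (al + 1) * F], with one it is
    [2 * al * F], absorbed by [alm2], and with none the branch to [v] is empty. *)
Lemma branch_sum_unreachable v w : v \in S -> w \in S -> v != w ->
  (forall y, y \in S -> y != v -> a y != v /\ b y != v) ->
  (P a b (S :\ v) v)%:R + (P a b (S :\ w) w)%:R <= al ^+ 2 * pot S S a b.
Proof.
move=> vS wS vw nopred.
have vSw : v \in S :\ w by rewrite !inE vw.
have -> : pot S S a b = wt S a b v * pot S (S :\ v) a b by apply: potentialD1.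
set F := pot S (S :\ v) a b.
have F0 : 0 < F by apply: potential_gt0.
have admw : admissible t (S :\ w) w := admissible_in adm (subxx _) wS.
have admv : admissible t (S :\ v) v := admissible_in adm (subxx _) vS.
have wF : (P a b (S :\ w) w)%:R <= al * F.
  apply: le_trans (_ : (P a b (S :\ v :\ w) w)%:R <= _).
    rewrite ler_nat setD1C; apply: npaths_unreachable => //.
    by move=> y; rewrite setD1K //; apply: nopred.
  apply: le_trans (bounded_in adm wf IH (subD1set _ _) wS) _.
  rewrite (setUidPr _) ?sub1set ?inE 1?eq_sym ?vw // ler_pM2l //.
  by apply: potential_sub; rewrite // setDDl subsetDl.
have IHv S' : (#|S'| < #|S :\ v|)%N -> forall a b u,
    admissible t S' u -> well_formed S' u a b -> bd S' a b u.
  by move=> lt; apply: IH; apply: ltn_trans lt _; apply: card_remove.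
have wfv : well_formed (S :\ v) v a b.
  by apply: (well_formed_sub wf); rewrite ?subD1set // !inE vS orbT.
have [/andP[aa bb]|nab] := boolP (alive t S v (a v) && alive t S v (b v)).
  have -> : wt S a b v = al by rewrite /weight aa bb.
  have vF : (P a b (S :\ v) v)%:R <= al * (al * F).
    apply: le_trans (bounded_in1 adm wf IH vS) _; rewrite ler_pM2l //.
    apply: le_trans (_ : pot S S a b <= _); first by apply: potential_sub; rewrite ?subD1set.
    by rewrite (potentialD1 t al m m S a b vS) /weight aa bb.
  apply: le_trans (lerD vF wF) _; rewrite al2; nra.
have [dead|] := boolP (~~ alive t S v (a v) && ~~ alive t S v (b v)).
  have nal x : ~~ alive t S v x -> ~~ alive t (S :\ v) v x.
    by apply: contraNN; apply: alive_sub; rewrite subD1set.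
  move: dead => /andP[/nal aa /nal bb].
  rewrite (npaths_branch 1 a b admv) !(branch_out _ _ _ admv) // muln0 add0r.
  apply: le_trans wF _; rewrite expr2 -mulrA ler_pM2l // mulrA ler_peMl ?(ltW F0) //.
  by rewrite -[1]mulr1 ler_pM // weight_ge1.
rewrite negb_and !negbK => one.
have -> : wt S a b v = m.
  by rewrite /weight; move: nab one; case: (alive t S v (a v)); case: (alive t S v (b v)).
have vF : (P a b (S :\ v) v)%:R <= al * F.
  apply: le_trans (npaths_single m1 (lexx m) mal admv wfv IHv (c := 1) _ _ _) _ => //.
    by apply: contraNN nab => /andP[aa bb]; rewrite !(alive_sub _ aa, alive_sub _ bb) ?subD1set.
  by rewrite mul1r ler_pM2l //; apply: potential_sub; rewrite ?subD1set.
apply: le_trans (lerD vF wF) _.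
have : 2 * (al * F) <= (al * m) * (al * F) by rewrite ler_pM2r // mulr_gt0.
nra.
Qed.

(** If both targets have another in-neighbour, then each branch loses a factor [m] and [alm2]
    concludes; otherwise one target is unreachable from the other branch. *)
Lemma branch_sum_one v w : v \in S -> w \in S -> v != w ->
  (P a b (S :\ v) v)%:R + (P a b (S :\ w) w)%:R <= al ^+ 2 * pot S S a b.
Proof.
move=> vS wS vw.
have dec x : x \in S -> (exists2 y, (y \in S) && (y != x) & a y = x \/ b y = x) \/
    (forall y, y \in S -> y != x -> a y != x /\ b y != x).
  move=> xS; have [/existsP[y /and3P[yS yx /orP E]]|/existsPn H] :=
      boolP [exists y, [&& y \in S, y != x & (a y == x) || (b y == x)]].
    by left; exists y; rewrite ?yS //; case: E => /eqP; [left|right].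
  right=> y yS yx; apply/andP; rewrite -negb_or; apply: contraNN (H y) => E.
  by rewrite yS yx.
have half x : x \in S -> (exists2 y, (y \in S) && (y != x) & a y = x \/ b y = x) ->
    m * (P a b (S :\ x) x)%:R <= al * pot S S a b.
  move=> xS [y /andP[yS yx] E].
  rewrite -ler_pdivlMl // mulrCA; apply: le_trans (bounded_in1 adm wf IH xS) _.
  rewrite ler_pM2l //; apply: (@potential_drop _ _ t al m m m1 _ _ _ _ _ _ _ _ y) => //.
  - exact: subD1set.
  - by rewrite invr_ge0 ltW.
  - exact: weight_lose_one.
case: (dec v vS) => [pv|]; last exact: branch_sum_unreachable.
case: (dec w wS) => [pw|nw]; last by rewrite addrC; apply: branch_sum_unreachable; rewrite 1?eq_sym.
have pos := potential_gt0 t m1 (lexx m) mal S S a b.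
have Hv := half v vS pv; have Hw := half w wS pw.
rewrite -(ler_pM2l mgt0) mulrDr; apply: le_trans (lerD Hv Hw) _.
have : 2 * (al * pot S S a b) <= (al * m) * (al * pot S S a b) by rewrite ler_pM2r // mulr_gt0.
nra.
Qed.

End Step.

Lemma bounded_one S a b u :
  admissible t S u -> well_formed S u a b -> bd S a b u.
Proof.
have [n] := ubnP #|S|; elim: n S a b u => // n IHn S a b u leS adm wf.
have IH S' : (#|S'| < #|S|)%N -> forall a b u,
    admissible t S' u -> well_formed S' u a b -> bd S' a b u.
  by move=> lt a' b' u'; apply: IHn; apply: leq_trans lt _.
apply: (bounded_step m1 (lexx m) mal adm wf IH) => //; rewrite ?mul1r //.
  by have := al2; nra.
by move=> aS bS; apply: (branch_sum_one adm wf IH) => //; apply: wf; rewrite setU11.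
Qed.

End KOne.

(** * Inequalities between the weights *)

Section Constants.
Local Open Scope ring_scope.
Variables (R : realFieldType) (K : nat) (al h l q : R).
Local Notation k := (K%:R : R).
Hypotheses (K2 : (2 <= K)%N) (al0 : 0 < al) (al2 : al ^+ 2 = k * al + 1).
Hypotheses (hal : h * al = k ^+ 2 + 1) (hq : h = q * al) (lq : k * l = (k + 1) * q).

Lemma k_ge2 : 2 <= k. Proof. by rewrite (ler_nat R 2). Qed.
Lemma k_lt_al : k < al. Proof. by have := al2; have := al0; nra. Qed.
Lemma al_le_half : 2 * al <= 2 * k + 1.
Proof. by have := al2; have := k_lt_al; have := k_ge2; nra. Qed.
Lemma sqr_k_lt : k ^+ 2 < k * al. Proof. by have := k_lt_al; have := k_ge2; nra. Qed.
Lemma k_al_le : k * al <= k ^+ 2 + 1.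
Proof. by have := al2; have := k_lt_al; have := k_ge2; nra. Qed.
Lemma qal2 : q * al ^+ 2 = k ^+ 2 + 1. Proof. by rewrite expr2 mulrA -hq. Qed.
Lemma q_gt0 : 0 < q.
Proof. by rewrite -(pmulr_lgt0 q (exprn_gt0 2 al0)) qal2; have := k_ge2; nra. Qed.
Lemma q_le1 : q <= 1.
Proof.
rewrite -(ler_pM2r (exprn_gt0 2 al0)) qal2 mul1r al2.
by have := sqr_k_lt; nra.
Qed.
Lemma h_le_al : h <= al. Proof. by rewrite hq ler_piMl ?q_le1 // ltW. Qed.
Lemma k_le_h : k <= h. Proof. by rewrite -(ler_pM2r al0) hal k_al_le. Qed.
Lemma k_gt0 : 0 < k. Proof. by have := k_ge2; lra. Qed.
Lemma l_le_h : l <= h.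
Proof.
rewrite -(ler_pM2l k_gt0) lq hq mulrCA mulrC ler_pM2l ?q_gt0 //.
by have := sqr_k_lt; have := k_ge2; nra.
Qed.
Lemma l_ge1 : 1 <= l.
Proof.
rewrite -(ler_pM2l k_gt0) lq -(ler_pM2r (exprn_gt0 2 al0)) -[leRHS]mulrA qal2 mulr1 al2.
by have := k_al_le; have := k_ge2; nra.
Qed.
Lemma k_le_al_pred : k <= al * (al - 1).
Proof. by have := al2; have := sqr_k_lt; have := al_le_half; have := k_ge2; nra. Qed.
(** Together with [heavy_none_gain], this says that a vertex losing its heavy edge keeps at most the
    fraction [(al - 1) / k] of its weight, whether it drops from [al] to [l] or from [h] to 1. *)
Lemma heavy_light_gain : k * l + al <= al ^+ 2.
Proof.
have : k * l <= k + 1 by rewrite lq ler_piMr ?q_le1 //; have := k_gt0; lra.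
by rewrite al2; have := k_lt_al; have := k_ge2; nra.
Qed.
Lemma heavy_none_gain : k + h <= al * h.
Proof.
rewrite mulrC hal; have := h_le_al; have := al_le_half; have := k_ge2; nra.
Qed.
(** The factor [al - k * q] is what the light branch may keep when the heavy branch keeps [q], since
    [k * (al * q) + al * (al - k * q) = al ^+ 2]. The next two lemmas show that losing a heavy edge
    achieves it. *)
Lemma light_slack : al ^+ 2 * ((al - k * q) * al) = al ^+ 2 + k ^+ 2.
Proof.
have -> : al ^+ 2 * ((al - k * q) * al) = al ^+ 2 * al ^+ 2 - k * al * (q * al ^+ 2) by ring.
by rewrite qal2 al2; have := al2; nra.
Qed.
Lemma light_light_gain : l <= (al - k * q) * al.
Proof.
rewrite -(ler_pM2l (exprn_gt0 2 al0)) light_slack.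
have kl : k * l <= k + 1 by rewrite lq ler_piMr ?q_le1 //; have := k_gt0; lra.
have al2k : al ^+ 2 <= k ^+ 3 by rewrite al2; have := k_al_le; have := k_ge2; nra.
rewrite -(ler_pM2l k_gt0) mulrCA mulrDr -exprS.
apply: le_trans (_ : al ^+ 2 * (k + 1) <= _); first by rewrite ler_pM2l ?exprn_gt0.
by rewrite mulrDr mulr1 [k * _]mulrC lerD2l.
Qed.
Lemma light_none_gain : 1 <= (al - k * q) * h.
Proof.
have al20 := exprn_gt0 2 al0.
rewrite hq -(ler_pM2l al20) mulr1.
have -> : al ^+ 2 * ((al - k * q) * (q * al)) = q * (al ^+ 2 * ((al - k * q) * al)) by ring.
rewrite light_slack mulrDr qal2 -(ler_pM2r al20) mulrDl [q * _ * _]mulrAC qal2 al2.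
have := k_al_le; have := sqr_k_lt; move: (k * al) => x lx xl.
have : (x + 1) * (x - k ^+ 2) <= (k ^+ 2 + 2) * 1 by rewrite ler_pM //; have := k_ge2; nra.
have k4 : 4 <= k ^+ 2 by have := k_ge2; nra.
by move: (k ^+ 2) k4 => y; nra.
Qed.
Lemma qh_ge1 : 1 <= q * h.
Proof.
rewrite -(ler_pM2r al0) mulrAC -hq mul1r; have := k_le_h; have := al_le_half; have := k_ge2; nra.
Qed.
Lemma one_light_each : q * (2 * k + al) <= al ^+ 2.
Proof.
rewrite -(ler_pM2r (exprn_gt0 2 al0)) mulrAC qal2.
(* For [K >= 3] the chain [2 * k + al <= k ^+ 2 + 1 <= al ^+ 2] suffices; its first inequality fails
   for [K = 2], where [al] is estimated numerically. *)
have [K3|] := leqP 3 K.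
  have k3 : 3 <= k by rewrite (ler_nat R 3).
  apply: (@le_trans _ _ ((k ^+ 2 + 1) * (k ^+ 2 + 1))).
    by rewrite ler_pM2l; have := al_le_half; nra.
  by rewrite ler_pM ?al2; have := sqr_k_lt; nra.
rewrite ltnS leq_eqVlt ltnNge K2 orbF => /eqP KE.
have k2 : k = 2 by rewrite KE.
have := al2; rewrite k2 => E; rewrite E.
have : 11 / 5 <= al by rewrite leNgt; apply/negP => ?; have := al0; nra.
have := al0; nra.
Qed.
(** The left side does not increase with [j], and at [j = 0] it is at most [k * al + 1]. *)
Lemma many_lights j : q ^+ j * (k * al + q * (1 + j%:R)) <= al ^+ 2.
Proof.
elim: j => [|j]; first by rewrite expr0 mul1r addr0 mulr1 al2 lerD2l q_le1.
apply: le_trans; rewrite exprSr -mulrA ler_pM2l ?exprn_gt0 ?q_gt0 //.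
rewrite -natr1; have j0 : 0 <= j%:R :> R by rewrite ler0n.
have q0 := q_gt0; have q1 := q_le1.
suff : q * (2 * q - 1) <= k * al * (1 - q).
  move=> H; have : 0 <= q * ((1 - q) * j%:R) by rewrite !mulr_ge0 ?(ltW q0) // subr_ge0.
  by nra.
have al20 := exprn_gt0 2 al0.
(* [d] equals [1 / al], so [al ^+ 2 * (1 - q) = k * d = 1 - d ^+ 2], which turns the goal into
   [d ^+ 2 <= 2 * q * (1 - q)]. *)
pose d := al - k.
have ald : al * d = 1 by rewrite mulrBr -expr2 al2; ring.
have kd : k * d = 1 - d ^+ 2 by rewrite -[X in X - _]ald /d; ring.
have alq : al ^+ 2 * (1 - q) = k * d by rewrite mulrBr mulr1 [_ * q]mulrC qal2 al2 /d; ring.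
have al_le : al <= 2 * q * k.
  rewrite -(ler_pM2r al20) mulrAC -[2 * q * _]mulrA qal2 -exprS.
  have -> : al ^+ 3 = (k ^+ 2 + 1) * al + k.
    rewrite exprS al2; have -> : al * (k * al + 1) = k * al ^+ 2 + al by ring.
    by rewrite al2; ring.
  by have := al_le_half; have := k_ge2; nra.
suff : d ^+ 2 <= 2 * q * (1 - q).
  have -> : k * al * (1 - q) = al ^+ 2 * (1 - q) - (1 - q) by rewrite al2; ring.
  by rewrite alq kd; nra.
have al30 := exprn_gt0 3 al0.
rewrite -(ler_pM2l al30).
have -> : al ^+ 3 * d ^+ 2 = al * (al * d) ^+ 2 by ring.
have -> : al ^+ 3 * (2 * q * (1 - q)) = 2 * q * (al * (al ^+ 2 * (1 - q))) by ring.
by rewrite alq [al * (k * d)]mulrCA ald expr1n !mulr1.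
Qed.
End Constants.

(** * The bound for [K >= 2] *)

Section KTwo.
Local Open Scope ring_scope.
Variables (R : realFieldType) (V : finType) (t : V) (K : nat) (al h l q : R).
Local Notation k := (K%:R : R).
Hypotheses (K2 : (2 <= K)%N) (al0 : 0 < al) (al2 : al ^+ 2 = k * al + 1).
Hypotheses (hal : h * al = k ^+ 2 + 1) (hq : h = q * al) (lq : k * l = (k + 1) * q).
Implicit Types (a b : V -> V) (S T : {set V}) (u v w x y z : V).
Local Notation bd := (bounded t K al h l).
Local Notation P := (npaths_hl t K).
Local Notation wt := (weight t al h l).
Local Notation pot := (potential t al h l).

Let l1 : 1 <= l := l_ge1 K2 al0 al2 hal hq lq.
Let lh : l <= h := l_le_h K2 al0 al2 hal hq lq.
Let h_al : h <= al := h_le_al K2 al0 al2 hal hq.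
Let k0 : 0 < k := k_gt0 R K2.
Let q0 : 0 < q := q_gt0 K2 al0 hal hq.
Let q1 : q <= 1 := q_le1 K2 al0 al2 hal hq.
Let h0 : 0 < h. Proof. by rewrite hq mulr_gt0. Qed.

Let weight_le := @weight_ge1 R V t al h l l1 lh h_al.
Let pot_gt0 := @potential_gt0 R V t al h l l1 lh h_al.
Let pot_sub := @potential_sub R V t al h l l1 lh h_al.
Let pot_drop := @potential_drop R V t al h l l1 lh h_al.
Let pot_expr := @potential_expr R V t al h l l1 lh h_al.

Section Step.
Variables (S : {set V}) (a b : V -> V) (u : V).
Hypotheses (adm : admissible t S u) (wf : well_formed S u a b).
Hypothesis IH : forall S', (#|S'| < #|S|)%N -> forall a b u,
  admissible t S' u -> well_formed S' u a b -> bd S' a b u.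

Let IH_in S' a' b' u' : S' \proper S -> admissible t S' u' ->
  well_formed S' u' a' b' -> bd S' a' b' u'.
Proof. by move=> /proper_card lt; apply: IH. Qed.

Let remove_proper x : x \in S -> S :\ x \proper S. Proof. exact: properD1. Qed.

Let adm_remove x : admissible t (S :\ x) u.
Proof. by apply: admissible_sub adm _; rewrite subD1set. Qed.

Lemma bounded_dead x : x \in S -> ~~ alive t S x (a x) -> ~~ alive t S x (b x) ->
  bd S a b u.
Proof.
move=> xS na nb; rewrite /bounded /npaths_hl (@npaths_dead _ _ _ _ _ x) //; last first.
  move=> y yS yx; rewrite /heavy_light.
  have [ay|_] := eqVneq (a x) y; first by rewrite /alive ay yS yx in na.
  have [ay|_] := eqVneq (b x) y; first by rewrite /alive ay yS yx in nb.
  by rewrite muln0.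
apply: le_trans (IH_in (remove_proper xS) (adm_remove x) _) _.
  by apply: (well_formed_sub wf); rewrite ?subD1set ?setU11.
rewrite ler_pM2l // -setU1D1 ?(u_neq adm) //.
rewrite (@potentialD1 _ _ t al h l S (u |: S) a b x) ?inE ?xS ?orbT //.
apply: le_trans (_ : pot S ((u |: S) :\ x) a b <= _); first by rewrite pot_sub ?subD1set.
by rewrite ler_peMl // ltW.
Qed.

(* Bypassing [x] gives every [y] with [{a y, b y} = {x, b x}] a bundle of [K.+1]
   parallel edges to [b x]. Trimming it to [K] edges loses a factor [K.+1 / K]
   once, as a path enters [b x] only once, and turns [y] into a vertex with
   a heavy edge only. *)
Lemma bounded_light x : x \in S -> ~~ alive t S x (a x) -> alive t S x (b x) ->
  bd S a b u.
Proof.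
move=> xS na /andP[]; set z := b x => zS zx.
have ux : u != x := u_neq adm xS.
have tx : t != x := t_neq adm xS.
pose A := heavy_light K a b.
pose B y v := (A y v + (v == z) * (A y x * A x z))%N.
have az : a x == z = false.
  by apply: contraNF na => /eqP->; rewrite /alive zS zx.
have Axz : A x z = 1%N by rewrite /A /heavy_light az -/z eqxx muln0.
have EB : npaths t A S u = npaths t B (S :\ x) u.
  apply: (npaths_bypass adm xS zS zx) => // v vS vx vz; rewrite /A /heavy_light -/z.
  have [ay|_] := eqVneq (a x) v; first by rewrite /alive ay vS vx in na.
  by rewrite eq_sym (negbTE vz) muln0.
pose confl y := (a y == x) && (b y == z) || (a y == z) && (b y == x).
(* In the trimmed graph a vertex with [confl] keeps its heavy edge to [z]; its light edge points to
   [x] and so is dead. *)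
pose a' y := if confl y || (a y == x) then z else a y.
pose b' y := if confl y then x else if b y == x then z else b y.
(* At [y = z] the bundle consists of self-loops, which no path uses. *)
pose C := [set y in (u |: S :\ x) | (y != z) && confl y].
have adm' := adm_remove x.
have neqT v : v \in t |: S :\ x -> x == v = false.
  by move=> vT; apply: contraTF vT => /eqP<-; rewrite !inE eqxx orbF eq_sym.
have inT y : y \in u |: S :\ x -> y \in u |: S.
  by apply: (subsetP (setUS _ (subD1set _ _))).
have nonconfl y v : y \in u |: S :\ x -> v \in t |: S :\ x -> v != y ->
    (~~ confl y \/ v != z) -> (B y v <= heavy_light K a' b' y v)%N.
  move=> yS vT vy H; rewrite /B Axz muln1 /A /heavy_light /a' /b'.
  have xv := neqT v vT.
  case: H => [nc|vz].
    rewrite (negbTE nc) /=.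
    have [ay|ay] := eqVneq (a y) x; have [bY|bY] := eqVneq (b y) x.
    + by have := wf (inT y yS); rewrite ay bY eqxx.
    + by rewrite ay xv muln0 add0n muln1 addn0 addnC [z == v]eq_sym mulnC.
    + by rewrite bY xv muln0 addn0 add0n muln1 [z == v]eq_sym.
    + by rewrite [(K * false)%N]muln0 !muln0 addn0.
  rewrite (negbTE vz) mul0n addn0; apply: leq_add.
    rewrite leq_mul2l; apply/orP; right; case: ifP => // c; have [ay|//] := eqVneq (a y) v.
    by move: c; rewrite /confl ay (negbTE vz) [v == x]eq_sym xv.
  case: ifP => [c|_]; last by have [->|//] := eqVneq (b y) x; rewrite xv.
  have [bY|//] := eqVneq (b y) v.
  by move: c; rewrite /confl bY (negbTE vz) [v == x]eq_sym xv !andbF.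
have wf' : well_formed (S :\ x) u a' b'.
  move=> y yS; have ab : a y != b y by apply: wf; apply: inT.
  rewrite /a' /b'; case c: (confl y) => //=.
  have [ay|ay] := eqVneq (a y) x; have [bY|bY] := eqVneq (b y) x => //.
  - by rewrite ay bY eqxx in ab.
  - by apply/eqP => E; move: c; rewrite /confl ay -E !eqxx.
  - by apply/eqP => E; move: c; rewrite /confl bY E !eqxx orbT.
have IH' := IH_in (remove_proper xS) adm' wf'.
have aliveA y : y \in u |: S :\ x -> alive t (S :\ x) y (a' y) -> alive t S y (a y).
  move=> yS; have xy : x != y.
    by apply: contraTneq yS => <-; rewrite !inE eqxx orbF eq_sym.
  have al_x : alive t S y x by rewrite /alive !inE xS orbT.
  rewrite /a' /confl; have [->//|ay] := eqVneq (a y) x; rewrite orbF /=.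
  by case: ifP => [/andP[/eqP-> _]|_]; apply: alive_sub; rewrite subD1set.
have aliveB y : y \in u |: S :\ x -> alive t (S :\ x) y (b' y) -> alive t S y (b y).
  move=> yS; have xy : x != y.
    by apply: contraTneq yS => <-; rewrite !inE eqxx orbF eq_sym.
  have al_x : alive t S y x by rewrite /alive !inE xS orbT.
  rewrite /b'; case: ifP => _; first by rewrite alive_removed.
  by have [->//|bY] := eqVneq (b y) x; apply: alive_sub; rewrite subD1set.
have wt_le y : y \in u |: S :\ x -> wt (S :\ x) a' b' y <= wt S a b y.
  move=> yS; apply: edge_weight_mono => //; [exact: aliveA|exact: aliveB].
have PhiE : pot S (u |: S) a b = l * pot S (u |: S :\ x) a b.
  rewrite (@potentialD1 _ _ t al h l S (u |: S) a b x) ?inE ?xS ?orbT // setU1D1 //.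
  by congr (_ * _); rewrite /weight (negbTE na) /alive -/z zS zx.
set Phi := pot S (u |: S :\ x) a b in PhiE.
have Phi0 : 0 < Phi by apply: pot_gt0.
rewrite /bounded PhiE {1}/npaths_hl EB.
have [C0|[y yC]] := set_0Vmem C.
  apply: le_trans (_ : (P a' b' (S :\ x) u)%:R <= _).
    rewrite ler_nat; apply: npaths_mono => // y v yS vT vy; apply: nonconfl => //.
    have [c|] := boolP (confl y); last by left.
    have : y \notin C by rewrite C0 inE.
    by rewrite inE yS c andbT negbK => /eqP yz; right; rewrite -yz.
  apply: le_trans IH' _; rewrite ler_pM2l //.
  apply: le_trans (_ : Phi <= _); last by rewrite ler_peMl // ltW.
  by apply: ler_prod => y yS; rewrite wt_le // andbT (le_trans ler01).
have ratio : (K * npaths t B (S :\ x) u <= K.+1 * P a' b' (S :\ x) u)%N.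
  apply: (@npaths_ratio _ _ _ _ z) => // [y' v yS vT vy vz|y' yS zT zy].
    by apply: nonconfl => //; right.
  have [c|c] := boolP (confl y'); last first.
    by apply: leq_mul => //; apply: nonconfl => //; left.
  rewrite /B Axz eqxx mul1n muln1 /A /heavy_light /a' /b' c /= eqxx (neqT z zT) muln1 addn0.
  rewrite [leqRHS]mulnC leq_mul2l; apply/orP; right.
  have zxf : z == x = false by rewrite eq_sym neqT.
  move: c => /orP[] /andP[/eqP-> /eqP->]; rewrite !eqxx ?(neqT z zT) ?zxf.
    by rewrite muln0 muln1 addn0 add0n.
  by rewrite muln0 muln1 addn0 add0n addn1.
have yS : y \in u |: S :\ x by move: yC; rewrite inE => /andP[].
have drop : pot (S :\ x) (u |: S :\ x) a' b' <= q * Phi.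
  rewrite -[q]expr1 -[1%N](cards1 y); apply: prod_le_expr.
  - by rewrite sub1set.
  - exact: ltW.
  - by move=> y' y'S; rewrite wt_le // andbT (le_trans ler01).
  move=> _ /set1P->; move: yC; rewrite inE yS => /andP[_ /andP[yz c]].
  have xy : x != y.
    by apply: contraTneq yS => <-; rewrite !inE eqxx orbF eq_sym.
  have ax : alive t S y x by rewrite /alive !inE xS orbT.
  have az' : alive t S y z by rewrite /alive zS eq_sym.
  rewrite /weight; have -> : alive t (S :\ x) y (b' y) = false.
    by rewrite /b' c alive_removed.
  have -> : alive t S y (a y) by move: c => /orP[]/andP[/eqP-> _].
  have -> : alive t S y (b y) by move: c => /orP[]/andP[_ /eqP->].
  by rewrite /edge_weight -hq; case: ifP => // _; apply: le_trans lh.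
rewrite -(ler_pM2l k0) -natrM.
apply: le_trans (_ : (k + 1) * (al * (q * Phi)) <= _).
  apply: le_trans (_ : (K.+1 * P a' b' (S :\ x) u)%:R <= _); first by rewrite ler_nat.
  rewrite natrM natr1 ler_pM2l ?ltr0n //; apply: le_trans IH' _; rewrite ler_pM2l //.
have -> : k * (al * (l * Phi)) = (k * l) * (al * Phi) by ring.
by rewrite lq le_eqVlt; apply/orP; left; apply/eqP; ring.
Qed.


Lemma weight_lose_light w y : w \in S -> y != w -> alive t S y (a y) -> a y != w ->
  b y = w -> wt (S :\ w) a b y <= q * wt S a b y.
Proof.
move=> wS yw ay aw bw; rewrite /weight ay bw alive_removed ?(t_neq adm) //.
rewrite (alive_remove ay aw) /alive inE wS orbT eq_sym yw /=.
by rewrite /edge_weight hq.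
Qed.

(** The two conditions on [c] match the two possible drops, from [al] to [l] and from [h] to 1. *)
Lemma weight_lose_heavy w y (c : R) : 0 <= c -> l <= c * al -> 1 <= c * h ->
  w \in S -> y != w -> a y = w -> wt (S :\ w) a b y <= c * wt S a b y.
Proof.
move=> c0 lc hc wS yw aw; rewrite /weight aw alive_removed ?(t_neq adm) //.
have -> : alive t S y w by rewrite /alive !inE wS orbT eq_sym yw.
rewrite /edge_weight; case: (boolP (alive t S y (b y))) => [_|nb].
  by case: ifP => // _; apply: le_trans l1 _.
by case: ifP => // /(alive_sub (subD1set _ _)) bb; rewrite bb in nb.
Qed.

Definition light_preds w := [set y in u |: S :\ w | b y == w].

(** Expand by the predecessor [y] of [w]. The paths avoiding [w] lose [q] at every predecessor, and
    one of these factors is traded for the wasted weight of [w], as [q * al = h]. In the term of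
    [y], contraction replaces the weights of [y] (which is [al]) and [w] by the weight of [w] alone;
    the freed [al] is the prefactor, and the other predecessors lose [q]. *)
Lemma npaths_light_preds w : w \in S ->
  (forall y, y \in u |: S -> y != w -> a y != w) -> alive t S w (a w) ->
  (0 < #|light_preds w|)%N -> (forall y, y \in light_preds w -> alive t S y (a y)) ->
  (P a b S u)%:R <=
    q ^+ (#|light_preds w|.-1) * (1 + #|light_preds w|%:R) * pot S (u |: S) a b.
Proof.
move=> wS noheavy aw; set D := light_preds w => D0 aD.
have uw : u != w := u_neq adm wS.
have tw : t != w := t_neq adm wS.
set T := u |: S :\ w.
have TE : T = (u |: S) :\ w by rewrite setU1D1.
have DT : D \subset T by apply/subsetP => y; rewrite inE => /andP[].
have wU : w \in u |: S by rewrite !inE wS orbT.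
pose a_ y y' := a (if y' == y then w else y').
pose b_ y y' := b (if y' == y then w else y').
have Tw y : y \in T -> (y \in u |: S) && (y != w).
  by rewrite TE !inE andbC.
have adm' := adm_remove w.
have -> : pot S (u |: S) a b = wt S a b w * pot S T a b.
  by rewrite (@potentialD1 _ _ t al h l S (u |: S) a b w) // TE.
have wh : h <= wt S a b w.
  by rewrite /weight aw /edge_weight; case: ifP.
have lose y : y \in D -> wt (S :\ w) a b y <= q * wt S a b y.
  move=> yD; have /Tw/andP[yS yw] := subsetP DT y yD.
  apply: weight_lose_light => //; [exact: aD|exact: noheavy|].
  by apply/eqP; move: yD; rewrite inE => /andP[].
set d := #|D| in D0 *.
have dE : d = d.-1.+1 by rewrite prednK.
have PT := pot_gt0 S T a b.
have base : (P a b (S :\ w) u)%:R <= q ^+ d.-1 * (wt S a b w * pot S T a b).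
  apply: le_trans (IH_in (remove_proper wS) adm' _) _.
    by apply: (well_formed_sub wf); rewrite ?subD1set ?setU11.
  apply: le_trans (_ : al * (q ^+ d * pot S T a b) <= _).
    by rewrite ler_pM2l // pot_expr ?subD1set // ltW.
  have -> : al * (q ^+ d * pot S T a b) = q ^+ d.-1 * (q * al * pot S T a b).
    by rewrite dE exprS /=; ring.
  by rewrite -hq ler_pM2l ?exprn_gt0 // ler_pM2r.
have term y : y \in D -> (P (a_ y) (b_ y) (S :\ w) u)%:R <= q ^+ d.-1 * (wt S a b w * pot S T a b).
  move=> yD; have yT := subsetP DT y yD; have /andP[yS yw] := Tw y yT.
  have wf' : well_formed (S :\ w) u (a_ y) (b_ y).
    move=> y' /Tw/andP[y'S _]; by rewrite /a_ /b_; case: (y' == y); apply: wf.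
  apply: le_trans (IH_in (remove_proper wS) adm' wf') _.
  rewrite (@potentialD1 _ _ t al h l _ _ _ _ y) // (@potentialD1 _ _ t al h l S T a b y) //.
  have -> : wt S a b y = al.
    rewrite /weight aD // /alive; move: yD; rewrite inE => /andP[_ /eqP->].
    by rewrite inE wS orbT eq_sym yw.
  have -> : pot (S :\ w) (T :\ y) (a_ y) (b_ y) = pot (S :\ w) (T :\ y) a b.
    apply: eq_bigr => y'; rewrite !inE => /andP[/negbTE y'y _].
    by rewrite /weight /a_ /b_ y'y.
  have le1 : wt (S :\ w) (a_ y) (b_ y) y <= wt S a b w.
    apply: edge_weight_mono; rewrite // /a_ /b_ eqxx.
    rewrite /alive => /andP[bT _]; rewrite (subsetP (setUS _ (subD1set S w)) _ bT).
    by apply: contraTneq bT => ->; rewrite !inE eqxx orbF eq_sym.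
  have le2 : pot (S :\ w) (T :\ y) a b <= q ^+ d.-1 * pot S (T :\ y) a b.
    have -> : d.-1 = #|D :\ y| by rewrite /d (cardsD1 y) yD.
    apply: pot_expr; rewrite ?subD1set ?setSD ?(ltW q0) // => y'; rewrite inE => /andP[_ y'D].
    exact: lose.
  have -> : q ^+ d.-1 * (wt S a b w * (al * pot S (T :\ y) a b)) =
      al * (wt S a b w * (q ^+ d.-1 * pot S (T :\ y) a b)) by ring.
  rewrite ler_pM2l //; apply: ler_pM => //.
    exact: le_trans ler01 (weight_le _ _ _ _).
  exact: ltW (pot_gt0 _ _ _ _).
pose A := heavy_light K a b.
apply: le_trans (_ : (P a b (S :\ w) u + \sum_(y in D) P (a_ y) (b_ y) (S :\ w) u)%:R <= _).
  rewrite ler_nat /npaths_hl.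
  apply: leq_trans (@npaths_in_expansion V t A (fun y => heavy_light K (a_ y) (b_ y))
    S u w adm wS (fun _ _ _ => erefl)) _.
  rewrite leq_add2l (bigID (fun y => b y == w)) /= [X in (_ + X)%N]big1 ?addn0.
    rewrite [leqRHS](eq_bigl (fun y => (y \in T) && (b y == w))); last by move=> y; rewrite inE.
    apply: leq_sum => y /andP[/Tw/andP[yS yw] /eqP bw].
    by rewrite /A /heavy_light (negbTE (noheavy y yS yw)) bw eqxx muln0 mul1n.
  move=> y /andP[/Tw/andP[yS yw] /negbTE bw].
  by rewrite /A /heavy_light (negbTE (noheavy y yS yw)) bw muln0.
rewrite natrD natr_sum -mulrA mulrDl mul1r mulrDr lerD //.
apply: le_trans (_ : \sum_(y in D) q ^+ d.-1 * (wt S a b w * pot S T a b) <= _).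
  exact: ler_sum.
by rewrite sumr_const -[leLHS]mulr_natl [leLHS]mulrCA.
Qed.


End Step.

(** * The induction step when all heavy edges are alive *)

Section Core.
Variables (S : {set V}) (a b : V -> V) (u : V).
Hypotheses (adm : admissible t S u) (wf : well_formed S u a b).
Hypothesis IH : forall S', (#|S'| < #|S|)%N -> forall a b u,
  admissible t S' u -> well_formed S' u a b -> bd S' a b u.
Hypothesis heavy : forall x, x \in S -> alive t S x (a x).

Let IH_sub x : x \in S -> forall S', (#|S'| < #|S :\ x|)%N -> forall a b u,
  admissible t S' u -> well_formed S' u a b -> bd S' a b u.
Proof. by move=> xS S' lt; apply: IH; apply: ltn_trans lt _; apply: card_remove. Qed.

Let adm_in x : x \in S -> admissible t (S :\ x) x.
Proof. by move=> xS; apply: (admissible_in adm). Qed.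

Let wf_in x : x \in S -> well_formed (S :\ x) x a b.
Proof. by move=> xS; apply: (well_formed_sub wf); rewrite ?subD1set // !inE xS orbT. Qed.

Let h_le_weight x : x \in S -> h <= wt S a b x.
Proof. by move=> xS; rewrite /weight heavy // /edge_weight; case: ifP. Qed.

Lemma branch_gain v c : v \in S -> pot (S :\ v) S a b <= c * pot S S a b ->
  (P a b (S :\ v) v)%:R <= al * (c * pot S S a b).
Proof.
by move=> vS le; apply: le_trans (bounded_in1 adm wf IH vS) _; rewrite ler_pM2l.
Qed.

Lemma branch_unreachable v w : v \in S -> w \in S -> v != w ->
  (forall y, y \in S -> y != v -> a y != v /\ b y != v) ->
  (P a b (S :\ w) w <= P a b (S :\ v :\ w) w)%N /\
  (P a b (S :\ w) w)%:R <= al * pot (S :\ v :\ w) (S :\ v) a b.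
Proof.
move=> vS wS vw nopred.
have vSw : v \in S :\ w by rewrite !inE vw.
have le : (P a b (S :\ w) w <= P a b (S :\ v :\ w) w)%N.
  rewrite setD1C; apply: (npaths_unreachable K (adm_in wS)) => //.
  by move=> y; rewrite setD1K //; apply: nopred.
split=> //; apply: le_trans (_ : (P a b (S :\ v :\ w) w)%:R <= _); first by rewrite ler_nat.
apply: le_trans (bounded_in adm wf IH (subD1set _ _) wS) _.
by rewrite (setUidPr _) // sub1set !inE eq_sym vw.
Qed.

Lemma potD1 x : x \in S -> pot S S a b = wt S a b x * pot S (S :\ x) a b.
Proof. exact: potentialD1. Qed.

(** The heavy branch wastes [w], whose weight is at least [h], so [k / h + 1 <= al] suffices, which
    is [heavy_none_gain]. *)
Lemma branch_sum_light_unreachable v w : v \in S -> w \in S -> v != w ->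
  (forall y, y \in S -> y != w -> a y != w /\ b y != w) ->
  k * (P a b (S :\ v) v)%:R + (P a b (S :\ w) w)%:R <= al ^+ 2 * pot S S a b.
Proof.
move=> vS wS vw nopred; rewrite eq_sym in vw.
have [_ Hv] := branch_unreachable wS vS vw nopred.
have Hv' : h * (P a b (S :\ v) v)%:R <= al * pot S S a b.
  apply: le_trans (_ : h * (al * pot S (S :\ w) a b) <= _).
    rewrite ler_pM2l //; apply: le_trans Hv _; rewrite ler_pM2l //.
    by apply: pot_sub; rewrite setDDl subsetDl.
  by rewrite mulrCA ler_pM2l // (potD1 wS) ler_pM2r ?pot_gt0 ?h_le_weight.
have Hw : h * (P a b (S :\ w) w)%:R <= h * (al * pot S S a b).
  rewrite ler_pM2l // -[pot S S a b]mul1r; apply: branch_gain => //.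
  by rewrite mul1r pot_sub ?subD1set.
rewrite -(ler_pM2l h0) mulrDr mulrCA.
apply: le_trans (lerD (_ : _ <= k * (al * pot S S a b)) Hw) _; first by rewrite ler_pM2l.
rewrite -mulrDl.
have := heavy_none_gain K2 al0 al2 hal hq.
have p0 : 0 < al * pot S S a b by rewrite mulr_gt0 ?pot_gt0.
rewrite -(ler_pM2r p0) => H; apply: le_trans H _.
by rewrite le_eqVlt; apply/orP; left; apply/eqP; ring.
Qed.

(** The light branch wastes [v]. If [v] has weight [al], this is enough by [al ^+ 2 = k * al + 1].
    If it has weight [h], a further factor [q] is needed: it comes from another vertex with an edge
    to [w], unless [v] itself leads to [w] or nothing does. *)
Lemma branch_sum_heavy_unreachable v w : v \in S -> w \in S -> v != w ->
  (forall y, y \in S -> y != v -> a y != v /\ b y != v) ->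
  k * (P a b (S :\ v) v)%:R + (P a b (S :\ w) w)%:R <= al ^+ 2 * pot S S a b.
Proof.
move=> vS wS vw nopred.
have [leQ Hw] := branch_unreachable vS wS vw nopred.
have p0 : 0 < pot S (S :\ v) a b := pot_gt0 _ _ _ _.
have Hv : (P a b (S :\ v) v)%:R <= al * (1 * pot S S a b).
  by apply: branch_gain => //; rewrite mul1r pot_sub ?subD1set.
rewrite mul1r in Hv.
have wt_gt0 : 0 < wt S a b v := lt_le_trans ltr01 (weight_le _ _ _ _).
(* It suffices that the light branch loses a factor [1 / al]. *)
have suff_w : al * pot (S :\ v :\ w) (S :\ v) a b <= pot S S a b ->
    k * (P a b (S :\ v) v)%:R + (P a b (S :\ w) w)%:R <= al ^+ 2 * pot S S a b.
  move=> lew; apply: le_trans (lerD (_ : _ <= k * (al * pot S S a b)) (le_trans Hw lew)) _.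
    by rewrite ler_pM2l.
  by rewrite al2 mulrDl mul1r mulrA.
have sub2 : S :\ v :\ w \subset S by rewrite setDDl subsetDl.
have [bv|nbv] := boolP (alive t S v (b v)).
  apply: suff_w; rewrite (potD1 vS) /weight heavy // bv /= ler_pM2l //.
  exact: pot_sub.
have wtv : wt S a b v = h by rewrite /weight heavy // (negbTE nbv).
have [avw|avw] := eqVneq (a v) w.
  have nbv' : ~~ alive t (S :\ v) v (b v).
    by apply: contraNN nbv; apply: alive_sub; rewrite subD1set.
  have Pv : P a b (S :\ v) v = (K * P a b (S :\ v :\ w) w)%N.
    rewrite (npaths_branch K a b (adm_in vS)) (branch_out K a b (adm_in vS) nbv') addn0.
    by rewrite avw (branch_in K a b (adm_in vS)) // !inE eq_sym vw.
  (* There are [k ^+ 2] ways to reach [w] through [v] and one directly; [h * al = k ^+ 2 + 1] is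
     made for this case. *)
  apply: le_trans (_ : (k ^+ 2 + 1) * (P a b (S :\ v :\ w) w)%:R <= _).
    by rewrite Pv natrM mulrDl mul1r expr2 mulrA lerD2l ler_nat.
  rewrite (potD1 vS) wtv -hal.
  have -> : al ^+ 2 * (h * pot S (S :\ v) a b) = h * al * (al * pot S (S :\ v) a b) by ring.
  rewrite ler_pM2l ?mulr_gt0 //; apply: le_trans (bounded_in adm wf IH (subD1set S v) wS) _.
  rewrite (setUidPr _) ?sub1set ?inE 1?eq_sym ?vw // ler_pM2l //; exact: pot_sub.
have [/existsP[y /and3P[yS yw pred]]|/existsPn nopredw] :=
    boolP [exists y, [&& y \in S, y != w & (a y == w) || (b y == w)]]; last first.
  apply: branch_sum_light_unreachable => // y yS yw; apply/andP; rewrite -negb_or.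
  by apply: contraNN (nopredw y) => E; rewrite yS yw.
(* The heavy edge of [v] goes elsewhere and its light edge is dead. *)
have yv : y != v.
  apply: contraTneq pred => ->; rewrite (negbTE avw) /=; apply: contraNneq nbv => ->.
  by rewrite /alive !inE wS orbT eq_sym.
apply: suff_w; rewrite (potD1 vS) wtv.
have -> (p : R) : h * p = al * (q * p) by rewrite hq; ring.
rewrite ler_pM2l //.
apply: (@pot_drop _ _ _ _ _ _ y); rewrite ?(ltW q0) ?inE ?yv //.
apply: le_trans (_ : wt (S :\ w) a b y <= _).
  by apply: weight_sub => //; rewrite setD1C subD1set.
have [ay|ay] := eqVneq (a y) w.
  apply: (weight_lose_heavy b adm) => //; rewrite ?(ltW q0) -?hq //.
  exact: qh_ge1 K2 al0 al2 hal hq.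
by apply: (weight_lose_light adm) => //; [exact: heavy|apply/eqP; move: pred; rewrite (negbTE ay)].
Qed.

(** Case analysis on the edges that enter [v] and [w] from other vertices of [S]: a heavy one into
    [v], none into [v], a heavy one into [w], none into [w], and finally only light ones into both,
    where one of the branches is expanded. *)
Lemma branch_sum_many v w : v \in S -> w \in S -> v != w ->
  k * (P a b (S :\ v) v)%:R + (P a b (S :\ w) w)%:R <= al ^+ 2 * pot S S a b.
Proof.
move=> vS wS vw.
have p0 : 0 < pot S S a b := pot_gt0 _ _ _ _.
have branch1 x : x \in S -> (P a b (S :\ x) x)%:R <= al * pot S S a b.
  move=> xS; rewrite -[pot S S a b]mul1r; apply: branch_gain => //.
  by rewrite mul1r pot_sub ?subD1set.
have drop c x y : 0 <= c -> x \in S -> y \in S -> wt (S :\ x) a b y <= c * wt S a b y ->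
    (P a b (S :\ x) x)%:R <= al * (c * pot S S a b).
  move=> c0 xS yS le; apply: branch_gain => //.
  by apply: (@pot_drop _ _ _ _ _ _ y); rewrite ?subD1set.
have al1 : 0 <= al - 1 by rewrite subr_ge0 (le_trans l1) // (le_trans lh).
have [/existsP[x /and3P[xS xv /eqP ax]]|/existsPn nheavyv] :=
    boolP [exists x, [&& x \in S, x != v & a x == v]].
  (* With this factor the heavy branch takes [al * (al - 1)], leaving [al] for the light one. *)
  have c0 : 0 <= (al - 1) / k by rewrite divr_ge0 // ltW.
  have le : wt (S :\ v) a b x <= (al - 1) / k * wt S a b x.
    apply: (weight_lose_heavy b adm) => //; rewrite mulrAC ler_pdivlMr // ?mul1r.
      have := heavy_light_gain K2 al0 al2 hal hq lq; rewrite [l * _]mulrC expr2; lra.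
    have := heavy_none_gain K2 al0 al2 hal hq; lra.
  apply: le_trans (lerD (_ : _ <= k * (al * ((al - 1) / k * pot S S a b))) (branch1 w wS)) _.
    by rewrite ler_pM2l // (drop _ _ x).
  have -> : k * (al * ((al - 1) / k * pot S S a b)) = k / k * (al * ((al - 1) * pot S S a b)).
    by ring.
  rewrite divff ?gt_eqF // mul1r le_eqVlt; apply/orP; left; apply/eqP; ring.
have avF y : y \in S -> y != v -> a y != v.
  by move=> yS yv; apply: contraNN (nheavyv y) => ->; rewrite yS yv.
pose J := [set y in S :\ v | b y == v].
have [J0|[x xJ]] := set_0Vmem J.
  apply: branch_sum_heavy_unreachable => // y yS yv; split; first exact: avF.
  have : y \notin J by rewrite J0 inE.
  by rewrite !inE yS yv.
have JS : J \subset S by apply/subsetP => y; rewrite !inE -andbA => /and3P[].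
have Jlose y : y \in J -> wt (S :\ v) a b y <= q * wt S a b y.
  rewrite !inE => /andP[/andP[yv yS] /eqP bY].
  by apply: (weight_lose_light adm) => //; [exact: heavy|exact: avF].
have xS : x \in S := subsetP JS x xJ.
have [/existsP[y /and3P[yS yw /eqP ay]]|/existsPn nheavyw] :=
    boolP [exists y, [&& y \in S, y != w & a y == w]].
  (* The heavy branch loses [q] at [x], which leaves the light branch the factor [al - k * q]. *)
  have kq : 0 <= al - k * q.
    have := light_light_gain K2 al0 al2 hal hq lq => H.
    by rewrite -(pmulr_lge0 _ al0) (le_trans _ H) // (le_trans ler01).
  have le : wt (S :\ w) a b y <= (al - k * q) * wt S a b y.
    apply: (weight_lose_heavy b adm) => //.
      exact: light_light_gain K2 al0 al2 hal hq lq.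
    exact: light_none_gain K2 al0 al2 hal hq.
  apply: le_trans (lerD (_ : _ <= k * (al * (q * pot S S a b))) (drop _ _ y kq wS yS le)) _.
    by rewrite ler_pM2l // (drop _ _ x (ltW q0)) // Jlose.
  by rewrite le_eqVlt; apply/orP; left; apply/eqP; ring.
have awF y : y \in S -> y != w -> a y != w.
  by move=> yS yw; apply: contraNN (nheavyw y) => ->; rewrite yS yw.
pose I := [set y in S :\ w | b y == w].
have IS : I \subset S by apply/subsetP => y; rewrite !inE -andbA => /and3P[].
have Ilose y : y \in I -> wt (S :\ w) a b y <= q * wt S a b y.
  rewrite !inE => /andP[/andP[yw yS] /eqP bY].
  by apply: (weight_lose_light adm) => //; [exact: heavy|exact: awF].
have [I0|[y yI]] := set_0Vmem I.
  apply: branch_sum_light_unreachable => // y yS yw; split; first exact: awF.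
  have : y \notin I by rewrite I0 inE.
  by rewrite !inE yS yw.
have yS : y \in S := subsetP IS y yI.
(* Expanding a branch at the other target, whose only in-edges are light. *)
have expand x1 x2 : x1 \in S -> x2 \in S -> x1 != x2 ->
    (forall y, y \in S -> y != x1 -> a y != x1) ->
    (forall y, y \in S -> y != x2 -> a y != x2) ->
    (0 < #|[set y in S :\ x2 | b y == x2]|)%N ->
    (P a b (S :\ x1) x1)%:R <= q ^+ (#|[set y in S :\ x2 | b y == x2]|.-1) *
      (1 + #|[set y in S :\ x2 | b y == x2]|%:R) * pot (S :\ x1) S a b.
  move=> x1S x2S x12 nh1 nh2.
  have x2S1 : x2 \in S :\ x1 by rewrite !inE eq_sym x12.
  have E : light_preds (S :\ x1) b x1 x2 = [set y in S :\ x2 | b y == x2].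
    by rewrite /light_preds setD1C setD1K // !inE x12.
  have ES : x1 |: S :\ x1 = S by rewrite setD1K.
  rewrite -E => D0; rewrite -[X in pot _ X]ES.
  apply: (npaths_light_preds (adm_in x1S) (wf_in x1S) (IH_sub x1S)) => //.
  - by move=> z; rewrite ES; apply: nh2.
  - by apply: alive_remove; [exact: heavy|apply: nh1; rewrite // eq_sym].
  - move=> z; rewrite E !inE => /andP[/andP[zx2 zS] _].
    have := heavy zS; have [->|zx1] := eqVneq z x1; last by move/alive_remove; apply; exact: nh1.
    by move=> H; apply: alive_remove => //; move: H => /andP[].
have Jpos : (0 < #|J|)%N by apply/card_gt0P; exists x.
have Ipos : (0 < #|I|)%N by apply/card_gt0P; exists y.
(* With a single light edge into [w], expanding the heavy branch at [w] gives [2 * q] in place of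
   [al * q]. *)
have [I2|I1] := leqP 2 #|I|; last first.
  have Icard : #|I| = 1%N by apply/eqP; rewrite eqn_leq -ltnS I1.
  have Hv : (P a b (S :\ v) v)%:R <= 2 * (q * pot S S a b).
    have := expand v w vS wS vw avF awF Ipos; rewrite -/I Icard expr0 mul1r => H.
    apply: le_trans H _; rewrite ler_pM2l ?addr_gt0 //.
    by apply: (@pot_drop _ _ _ _ _ _ x); rewrite ?subD1set ?(ltW q0) // Jlose.
  apply: le_trans (lerD (_ : _ <= k * (2 * (q * pot S S a b)))
    (drop _ _ y (ltW q0) wS yS (Ilose y yI))) _; first by rewrite ler_pM2l.
  have := one_light_each K2 al0 al2 hal hq; rewrite -(ler_pM2r p0) => H.
  by apply: le_trans _ H; rewrite le_eqVlt; apply/orP; left; apply/eqP; ring.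
(* With at least two light edges into [w], the light branch is expanded at [v] instead: it loses
   [q ^+ 2] through [I], while the heavy branch loses [q ^+ j] through [J]. *)
set j := #|J| in Jpos.
have Hv : (P a b (S :\ v) v)%:R <= al * (q ^+ j * pot S S a b).
  by apply: branch_gain => //; apply: pot_expr; rewrite ?subD1set ?(ltW q0).
have Hw : (P a b (S :\ w) w)%:R <= q ^+ j.-1 * (1 + j%:R) * (q ^+ 2 * pot S S a b).
  have wv : w != v by rewrite eq_sym.
  apply: le_trans (expand w v wS vS wv awF avF Jpos) _.
  rewrite ler_pM2l; last by rewrite mulr_gt0 ?exprn_gt0 // ltr_wpDr ?ler0n.
  apply: le_trans (_ : q ^+ #|I| * pot S S a b <= _).
    by apply: pot_expr; rewrite ?subD1set ?(ltW q0).
  by rewrite ler_pM2r // ler_wiXn2l // ltW.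
apply: le_trans (lerD (_ : _ <= k * (al * (q ^+ j * pot S S a b))) Hw) _.
  by rewrite ler_pM2l.
have := many_lights K2 al0 al2 hal hq j; rewrite -(ler_pM2r p0) => H.
apply: le_trans _ H; rewrite le_eqVlt; apply/orP; left; apply/eqP.
have -> : q ^+ j = q * q ^+ j.-1 by rewrite -exprS prednK.
ring.
Qed.

End Core.

Lemma bounded_many S a b u :
  admissible t S u -> well_formed S u a b -> bd S a b u.
Proof.
have [n] := ubnP #|S|; elim: n S a b u => // n IHn S a b u leS adm wf.
have IH S' : (#|S'| < #|S|)%N -> forall a b u,
    admissible t S' u -> well_formed S' u a b -> bd S' a b u.
  by move=> lt a' b' u'; apply: IHn; apply: leq_trans lt _.
have [/existsP[x /andP[xS nax]]|/existsPn Hheavy] :=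
    boolP [exists x, (x \in S) && ~~ alive t S x (a x)].
  by have [|] := boolP (alive t S x (b x)); [apply: bounded_light|apply: bounded_dead].
have heavy x : x \in S -> alive t S x (a x).
  by move=> xS; apply: contraNT (Hheavy x) => ->; rewrite xS.
apply: (bounded_step l1 lh h_al adm wf IH) => //; first exact: ltnW.
- exact: k_le_h K2 al0 al2 hal.
- exact: k_le_al_pred K2 al0 al2.
by move=> aS bS; apply: (branch_sum_many adm wf IH) => //; apply: wf; rewrite setU11.
Qed.

End KTwo.

(** * Choice of the weights and the resulting bound on paths *)

Section UpperPaths.
Local Open Scope ring_scope.
Variables (R : rcfType) (V : finType) (t : V).
Implicit Types (a b : V -> V) (S : {set V}) (u v : V).

Lemma potential_le_expr (al h l : R) S (T : {set V}) a b :
  1 <= l -> l <= h -> h <= al -> potential t al h l S T a b <= al ^+ #|T|.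
Proof.
move=> l1 lh hal; rewrite -prodr_const; apply: ler_prod => y _.
rewrite (le_trans ler01) ?weight_ge1 //= /weight /edge_weight.
by case: ifP; case: ifP => // _ _; by do ?[apply: le_trans hal | apply: le_trans lh].
Qed.

(** The exponent consists of the prefactor [al] and one factor [al] for each vertex of [u |: S]. *)
Lemma npaths_le_expr (K : nat) (al : R) (A : V -> V -> nat) S u :
  (0 < K)%N -> 0 < al -> al ^+ 2 = K%:R * al + 1 -> admissible t S u ->
  (forall y, y \in u |: S -> (forall v, v \in (t |: S) :\ y -> (A y v <= K)%N) /\
     (\sum_(v in (t |: S) :\ y) A y v <= K.+1)%N) ->
  (npaths t A S u)%:R <= al ^+ #|S|.+2.
Proof.
move=> K0 al0 al2 adm rows; have [a [b [wf le]]] := npaths_heavy_light adm rows.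
apply: le_trans (_ : (npaths_hl t K a b S u)%:R <= _); first by rewrite ler_nat.
have cardU : #|u |: S| = #|S|.+1 by rewrite cardsU1 (u_notin adm).
suff [h [l [l1 lh hal bd]]] : exists h l, [/\ 1 <= l, l <= h, h <= al & bounded t K al h l S a b u].
  apply: le_trans bd _; rewrite exprS ler_pM2l // -cardU; exact: potential_le_expr.
have [K2|] := leqP 2 K.
  (* [h] is forced by the pattern where [u] has a heavy edge to [v] and a light
     one to [w], and [v] only a heavy edge to [w]: the [K ^ 2 + 1] paths from [u]
     to [w] must be at most [al * h]. [l] makes [bounded_light] tight. *)
  pose h := (K%:R ^+ 2 + 1) / al; pose q := h / al; pose l := (K%:R + 1) * q / K%:R.
  have aln : al != 0 by rewrite gt_eqF.
  have hE : h * al = K%:R ^+ 2 + 1 by rewrite divfK.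
  have hq : h = q * al by rewrite divfK.
  have lq : K%:R * l = (K%:R + 1) * q by rewrite mulrC divfK // pnatr_eq0 -lt0n.
  exists h, l; split.
  - exact: l_ge1 K2 al0 al2 hE hq lq.
  - exact: l_le_h K2 al0 al2 hE hq lq.
  - exact: h_le_al K2 al0 al2 hE hq.
  - exact: (bounded_many K2 al0 al2 hE hq lq adm wf).
move=> K1; have K1' : K = 1%N by apply/eqP; rewrite eqn_leq -ltnS K1.
subst K; rewrite mul1r in al2.
have al1 : 1 <= al by rewrite leNgt; apply/negP => ?; nra.
have m1 : 1 <= Num.sqrt al by rewrite -[leLHS]sqrtr1 ler_wsqrtr.
have mm : Num.sqrt al ^+ 2 = al by rewrite sqr_sqrtr // ltW.
exists (Num.sqrt al), (Num.sqrt al); split=> //; last exact: bounded_one.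
by rewrite -[leRHS]mm expr2 ler_peMr // (le_trans ler01).
Qed.

End UpperPaths.

(** * Cycles as closed walks *)

Section Walks.
Variables (n : nat) (G : digraph n).
Implicit Types (t u v r : 'I_n) (S : {set 'I_n}) (e f : edge G) (c p : seq (edge G)).

Local Notation linked := (fun e f : edge G => target e == source f).

Definition edges_into u S := enum [pred e : edge G | (source e == u) && (target e \in S)].

(** Lists as edge sequences the paths that [npaths] counts; the fuel [m] is sufficient once it is at
    least the size of [S]. *)
Fixpoint walks m t S u : seq (seq (edge G)) :=
  [seq [:: e] | e <- edges_into u [set t]] ++
  if m is m'.+1 then
    [seq e :: p | e <- edges_into u S, p <- walks m' t (S :\ target e) (target e)]
  else [::].

Lemma card_edges u v : #|[pred e : edge G | (source e == u) && (target e == v)]| = G u v.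
Proof.
pose f (i : 'I_(G u v)) : edge G :=
  Tagged (fun uv : 'I_n * 'I_n => 'I_(G uv.1 uv.2)) (i : 'I_(G (u, v).1 (u, v).2)).
have finj : injective f by move=> i j /eqP; rewrite /f -tag_eqE /tag_eq eqxx /= tagged_asE => /eqP.
rewrite -[RHS]card_ord -(card_codom finj); apply: eq_card => e.
rewrite inE; apply/andP/codomP => [[]|[i ->]]; last by rewrite /source /target !eqxx.
case: e => [[x y] i]; rewrite /source /target /= => /eqP xu /eqP yv.
by subst x y; exists i.
Qed.

Lemma size_edges_into u v : size (edges_into u [set v]) = G u v.
Proof.
by rewrite /edges_into -cardE -card_edges; apply: eq_card => e; rewrite !inE.
Qed.

Lemma size_walks m t S u : #|S| <= m -> size (walks m t S u) = npaths t (fun x y => G x y) S u.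
Proof.
elim: m S u => [|m IH] S u leS /=.
  move: leS; rewrite leqn0 cards_eq0 => /eqP->.
  by rewrite cats0 size_map size_edges_into npathsE big_set0 addn0.
rewrite size_cat size_map size_edges_into npathsE; congr addn.
rewrite size_allpairs_dep sumnE big_map /edges_into big_enum /=.
rewrite (partition_big (@target n G) (fun v => v \in S)) /=; last by move=> e /andP[].
apply: eq_bigr => v vS.
rewrite (eq_bigr (fun=> npaths t (fun x y => G x y) (S :\ v) v)).
  rewrite sum_nat_const -(card_edges u v); congr muln; apply: eq_card => e.
  rewrite [in LHS]unfold_in !inE /=.
  by case: (eqVneq (target e) v) => [->|]; rewrite ?andbF ?vS // ?andbT.
move=> e /andP[/andP[_ eS] /eqP <-]; apply: IH.
by move: leS; rewrite (cardsD1 (target e)) eS.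
Qed.

Lemma walks_sound m t S u c : u \notin S -> c \in walks m t S u ->
  exists e p, [/\ c = e :: p, source e = u, path linked e p, target (last e p) = t
    & uniq (map (@source n G) p) /\ {subset map (@source n G) p <= S}].
Proof.
elim: m S u c => [|m IH] S u c uS /=; rewrite mem_cat => /orP[].
- move=> /mapP[e]; rewrite mem_enum !inE => /andP[/eqP eu /eqP et] ->.
  by exists e, [::]; split.
- by [].
- move=> /mapP[e]; rewrite mem_enum !inE => /andP[/eqP eu /eqP et] ->.
  by exists e, [::]; split.
move=> /allpairsPdep[e [p [eS pw ->]]].
move: eS; rewrite mem_enum inE => /andP[/eqP eu eS].
have [|f [p' [pE fs pp pl [pu ps]]]] := IH _ _ _ _ pw; first by rewrite !inE eqxx.
exists e, p; subst p; split => //=.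
- by rewrite fs eqxx.
- split.
    by rewrite fs pu andbT; apply/negP => /ps; rewrite !inE eqxx.
  move=> x; rewrite inE => /orP[/eqP->|/ps]; first by rewrite fs.
  by rewrite inE => /andP[].
Qed.

Lemma walks_complete m t S u e p : size p <= m -> source e = u ->
  path linked e p -> target (last e p) = t -> uniq (map (@source n G) p) ->
  {subset map (@source n G) p <= S} -> (e :: p) \in walks m t S u.
Proof.
have base m' S' u' e' : source e' = u' -> target e' = t -> [:: e'] \in walks m' t S' u'.
  move=> eu et; case: m' => [|m'] /=; rewrite mem_cat; apply/orP; left; apply/mapP; exists e' => //;
  by rewrite mem_enum !inE eu et !eqxx.
elim: m S u e p => [|m IH] S u e [|f p] //; try by move=> _ eu _ et _ _; apply: base.
rewrite /=.
rewrite ltnS => sp eu /andP[/eqP ef pp] pl /andP[fu pu] ps.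
rewrite mem_cat; apply/orP; right; apply/allpairsPdep; exists e, (f :: p); split => //.
  by rewrite mem_enum inE eu eqxx ef ps ?mem_head.
apply: IH => // x xp; rewrite inE ef ps ?inE ?xp ?orbT // andbT.
by apply: contraNneq fu => <-.
Qed.

Lemma walks_uniq m t S u : uniq (walks m t S u).
Proof.
elim: m S u => [|m IH] S u /=; rewrite cat_uniq.
  by rewrite map_inj_uniq ?enum_uniq // => e f [].
rewrite map_inj_uniq ?enum_uniq //=; last by move=> e f [].
apply/andP; split.
  apply/hasPn => c /allpairsPdep[e [p [_ pw ->]]]; apply/mapP => -[f _ [_ p0]].
  by move: pw; rewrite p0; case: (m) => [|m'] /=; rewrite mem_cat => /orP[/mapP[]|] //;
    move=> /allpairsPdep[? [? []]].
apply: allpairs_uniq_dep => [|e _|]; rewrite ?enum_uniq //.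
by move=> [e p] [f p'] _ _ /= [-> ->].
Qed.

(** No two edges of a walk share their source, so the starting vertex determines the first edge,
    whose target determines the next one, and so on. *)
Lemma walk_eq_mem c c' u : uniq (map (@source n G) c) -> uniq (map (@source n G) c') ->
  head u (map (@source n G) c) = head u (map (@source n G) c') ->
  sorted linked c -> sorted linked c' -> c =i c' -> c = c'.
Proof.
elim: c c' u => [|e p IH] [|f p'] u //=.
- by move=> _ _ _ _ _ /(_ f); rewrite !inE eqxx.
- by move=> _ _ _ _ _ /(_ e); rewrite !inE eqxx.
move=> /andP[ep up] /andP[fp up'] ef pe pf E.
have notin (x y : edge G) q : source x \notin map (@source n G) q ->
    y \in q -> source y != source x.
  by move=> xq yq; apply: contraNneq xq => <-; apply: map_f.
have fe : f = e.
  have : e \in f :: p' by rewrite -E mem_head.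
  by rewrite inE => /orP[/eqP->//|/(notin _ _ _ fp)]; rewrite ef eqxx.
subst f; congr cons; apply: (IH p' (target e)) => //.
- move: pe pf; case: (p) => [|x q]; case: (p') => [|y q'] //=.
  + by move=> _ /andP[/eqP].
  + by move=> /andP[/eqP].
  + by move=> /andP[/eqP<- _] /andP[/eqP<- _].
- exact: path_sorted pe.
- exact: path_sorted pf.
move=> x; have := E x; rewrite !inE; have [->|//] := eqVneq x e.
have nin (q : seq (edge G)) : source e \notin [seq source i | i <- q] -> (e \in q) = false.
  by apply: contraNF; apply: map_f.
by rewrite !nin.
Qed.

(* The inner vertices of the cycles whose least vertex is [r]. *)
Definition later r := [set v : 'I_n | r < v].

Lemma num_cycles_le :
  num_cycles G <= \sum_(r < n) npaths r (fun x y => G x y) (later r) r.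
Proof.
pose all_walks := flatten [seq walks #|later r| r (later r) r | r <- enum 'I_n].
have -> : \sum_(r < n) npaths r (fun x y => G x y) (later r) r = size all_walks.
  rewrite size_flatten /shape -map_comp sumnE big_map big_enum /=.
  by apply: eq_bigr => r _; rewrite size_walks.
rewrite -(size_map (fun c => [set e in c])) /num_cycles cardE.
apply: uniq_leq_size => [|A]; first exact: enum_uniq.
rewrite mem_enum inE => /is_cycleP[c [/and3P[c0 cyc uc] ->]].
case: c c0 cyc uc => // e0 c0 _ cyc uc.
set c := e0 :: c0 in cyc uc *.
(* The cycle is rotated to start at its least vertex. *)
have [e ec emin] := @arg_minnP _ e0 (fun e => e \in c) (fun e => source e : nat) (mem_head _ _).
have [i p cE] := rot_to ec.
have cyc' : cycle linked (e :: p) by rewrite -cE rot_cycle.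
have uc' : uniq (map (@source n G) (e :: p)) by rewrite -cE map_rot rot_uniq.
apply/mapP; exists (e :: p); last first.
  by apply/setP => x; rewrite !in_set -(mem_rot i c) cE.
apply/flattenP; exists (walks #|later (source e)| (source e) (later (source e)) (source e)).
  by apply/mapP; exists (source e); rewrite // mem_enum.
move: cyc' uc'; rewrite /= rcons_path => /andP[pp /eqP pl] /andP[ep up].
have sub : {subset map (@source n G) p <= later (source e)}.
  move=> x xp; rewrite inE ltn_neqAle; move: xp => /mapP[f fp ->].
  rewrite emin ?andbT; last by rewrite -(mem_rot i) cE inE fp orbT.
  by apply: contraNneq ep => /val_inj ->; apply: map_f.
apply: walks_complete => //.
rewrite -(size_map (@source n G)) -(card_uniqP up); apply: subset_leq_card.
exact/subsetP.
Qed.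

Lemma npaths_le_num_cycles r S : r \notin S ->
  npaths r (fun x y => G x y) S r <= num_cycles G.
Proof.
move=> rS; rewrite -(@size_walks #|S|) // -(size_map (fun c => [set e in c])).
rewrite /num_cycles [leqRHS]cardE; apply: uniq_leq_size.
  rewrite map_inj_in_uniq ?walks_uniq // => c c'.
  move=> /(walks_sound rS)[e [p [-> eu pp pl [up ps]]]].
  move=> /(walks_sound rS)[e' [p' [-> eu' pp' pl' [up' ps']]]] /setP E.
  apply: (@walk_eq_mem _ _ r) => //=.
  - by rewrite up andbT eu; apply: contra rS; apply: ps.
  - by rewrite up' andbT eu'; apply: contra rS; apply: ps'.
  - by rewrite eu eu'.
  - by move=> x; have := E x; rewrite !in_set.
move=> _ /mapP[c cw ->]; rewrite mem_enum inE; apply/is_cycleP; exists c; split => //.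
have [e [p [-> eu pp pl [up ps]]]] := walks_sound rS cw.
apply/and3P; split => //=; first by rewrite rcons_path pp pl eu eqxx.
by rewrite up andbT eu; apply: contra rS; apply: ps.
Qed.

End Walks.

(** * Bounds on the number of cycles *)

Section UpperBound.
Local Open Scope ring_scope.
Variables (R : rcfType) (K : nat) (al : R).
Hypotheses (K0 : (0 < K)%N) (al0 : 0 < al) (al2 : al ^+ 2 = K%:R * al + 1).

Lemma al_gt1 : 1 < al.
Proof.
have K1 : 1 <= K%:R :> R by rewrite ler1n.
rewrite ltNge; apply/negP => le1.
have : al * al <= al by rewrite ler_piMr // ltW.
have : al <= K%:R * al by rewrite ler_peMl // ltW.
have := al2; rewrite expr2; lra.
Qed.

Let al1 : 1 <= al. Proof. exact: ltW al_gt1. Qed.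

Lemma card_later n (r : 'I_n) : #|later r| = (n - r.+1)%N.
Proof.
rewrite -sum1_card (eq_bigl (fun v : 'I_n => (r.+1 <= v)%N)); last by move=> v; rewrite inE.
by rewrite -(big_geq_mkord _ _ xpredT (fun=> 1%N)) sum_nat_const_nat muln1.
Qed.

Lemma geometric_sum_le n : \sum_(r < n) al ^+ (n - r) <= al / (al - 1) * al ^+ n.
Proof.
have d0 : 0 < al - 1 by rewrite subr_gt0 al_gt1.
rewrite mulrAC ler_pdivlMr //; elim: n => [|n IH]; first by rewrite big_ord0 mul0r expr0 mulr1 ltW.
rewrite big_ord_recl subn0 mulrDl; under eq_bigr do rewrite /= subSS.
apply: le_trans (lerD (lexx _) IH) _; rewrite exprS le_eqVlt; apply/orP; left; apply/eqP; ring.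
Qed.

Variables (n : nat) (G : digraph n).
Hypothesis GG : Gmulti K.+1 G.

Lemma Gmulti_row y (D : {set 'I_n}) : y \notin D ->
  (forall v, v \in D -> (G y v <= K)%N) /\ (\sum_(v in D) G y v <= K.+1)%N.
Proof.
move: GG => /andP[/forallP/(_ y)/eqP od /forallP/(_ y)/forallP mult] yD; split.
  move=> v vD; have := mult v; rewrite subn1 => /implyP; apply.
  by apply: contraNneq yD => ->.
rewrite -od /outdegree [leqRHS](bigID (mem D)) /=; exact: leq_addr.
Qed.

(** Source and target coincide here, which [admissible] excludes; so the first edge, one of at most
    [K.+1], is split off. Behind it [n - r - 2] inner vertices remain, and the exponent is
    [n - r]. *)
Lemma npaths_later_le (r : 'I_n) :
  (npaths r (fun x y => G x y) (later r) r)%:R <= K.+1%:R * al ^+ (n - r).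
Proof.
have rS : r \notin later r by rewrite inE ltnn.
have pow1 : 1 <= al ^+ (n - r) by rewrite exprn_ege1.
have [/forallP/(_ r)/eqP od _] := andP GG.
rewrite npathsE natrD natr_sum.
apply: le_trans (_ : (G r r)%:R * al ^+ (n - r) +
    \sum_(v in later r) (G r v)%:R * al ^+ (n - r) <= _).
  apply: lerD; first by rewrite ler_peMr ?ler0n.
  apply: ler_sum => v vS; rewrite natrM ler_wpM2l ?ler0n //.
  have adm : admissible r (later r :\ v) v.
    rewrite /admissible setD1K // rS andbT !inE eqxx //.
  apply: le_trans (npaths_le_expr K0 al0 al2 adm _) _.
    by move=> y yS; apply: Gmulti_row; rewrite !inE eqxx.
  have := cardsD1 v (later r); rewrite vS card_later add1n => <-.
  by rewrite subnSK.
rewrite -mulr_suml -mulrDl ler_pM2r ?(lt_le_trans ltr01) //.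
rewrite -natr_sum -natrD ler_nat -od /outdegree.
rewrite [leqRHS](bigD1 r) //= leq_add2l [leqRHS](bigID (fun v => v \in later r)) /=.
apply: leq_trans (leq_addr _ _); rewrite big_mkcond [leqRHS]big_mkcond /=.
apply: leq_sum => v _; case: ifP => // vS; rewrite andbT ifT //.
by apply: contraTneq vS => ->.
Qed.

Lemma num_cycles_le_expr :
  (num_cycles G)%:R <= K.+1%:R * (al / (al - 1)) * al ^+ n.
Proof.
apply: le_trans (_ : (\sum_(r < n) npaths r (fun x y => G x y) (later r) r)%:R <= _).
  by rewrite ler_nat num_cycles_le.
rewrite natr_sum -mulrA.
apply: le_trans (_ : K.+1%:R * \sum_(r < n) al ^+ (n - r) <= _).
  by rewrite mulr_sumr; apply: ler_sum => r _; apply: npaths_later_le.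
by rewrite ler_pM2l ?ltr0n // geometric_sum_le.
Qed.

End UpperBound.

(** * The lower bound: a graph with Fibonacci-like path counts *)

Section LowerBound.
Local Open Scope ring_scope.
Variables (R : rcfType) (K : nat) (al : R).
Hypotheses (K0 : (0 < K)%N) (al0 : 0 < al) (al2 : al ^+ 2 = K%:R * al + 1).
Variable N : nat.
Local Notation V := 'I_N.+2.
Implicit Types (i j v : V) (S : {set V}).

Definition next1 i : V := if (i < N.+1)%N then inord i.+1 else ord0.
(** The last two vertices get a light self-loop, which keeps their outdegree at [K.+1]. *)
Definition next2 i : V := if (i < N)%N then inord i.+2 else i.
Definition step_graph : digraph N.+2 := (\matrix_(i, j) heavy_light K next1 next2 i j)%R.

Lemma next1E i : (i < N.+1)%N -> next1 i = i.+1 :> nat.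
Proof. by move=> iN; rewrite /next1 iN inordK. Qed.
Lemma next2E i : (i < N)%N -> next2 i = i.+2 :> nat.
Proof. by move=> iN; rewrite /next2 iN inordK // ltnS ltnS. Qed.
Lemma next1_neq i : next1 i != i.
Proof.
rewrite -val_eqE /=; have [iN|iN] := ltnP i N.+1; first by rewrite next1E // gtn_eqF.
by rewrite /next1 ltnNge iN /= ltn_eqF // (leq_ltn_trans _ iN).
Qed.
Lemma next12 i : next1 i != next2 i.
Proof.
have [iN|iN] := ltnP i N; last by rewrite /next2 ltnNge iN /= next1_neq.
by rewrite -val_eqE /= next1E ?next2E // ?ltn_eqF // ltnW.
Qed.

Lemma step_graph_Gmulti : Gmulti K.+1 step_graph.
Proof.
apply/andP; split; apply/forallP => u.
  have -> : outdegree step_graph u =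
      (\sum_(v in [set: V]) (K * (next1 u == v) + (next2 u == v)) * 1)%N.
    by apply: eq_big => v; rewrite ?inE // mxE muln1.
  by rewrite sum_heavy_light !inE !mul1n muln1 addn1.
apply/forallP => v; apply/implyP => uv; rewrite mxE subn1 /= /heavy_light.
have [E|_] := eqVneq (next1 u) v; last first.
  by rewrite muln0; case: eqP.
by rewrite -E eq_sym (negbTE (next12 u)) muln1 addn0.
Qed.

(** The path counts satisfy the recursion [al ^+ m.+2 = K * al ^+ m.+1 + al ^+ m], with [m] the
    distance to the last vertex. The factor 2 serves the base case [m = 1], through
    [al <= 2 * K]. *)
Lemma npaths_step_graph m S i : (i + m = N.+1)%N -> ord0 \notin S ->
  (forall v, (i < v)%N -> v \in S) ->
  al ^+ m <= 2 * (npaths ord0 (fun x y => step_graph x y) S i)%:R.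
Proof.
have K1 : 1 <= K%:R :> R by rewrite ler1n.
have alK : al <= 2 * K%:R by rewrite leNgt; apply/negP => ?; have := al2; nra.
elim/ltn_ind: m S i => m IH S i im S0 Si.
have rowE (f : V -> nat) : (\sum_(v in S) step_graph i v * f v)%N =
    (K * ((next1 i \in S) * f (next1 i)) + (next2 i \in S) * f (next2 i))%N.
  by rewrite -sum_heavy_light; apply: eq_bigr => v _; rewrite mxE.
have sub m' j : (m' < m)%N -> (i < j)%N -> (j + m' = N.+1)%N ->
    al ^+ m' <= 2 * (npaths ord0 (fun x y => step_graph x y) (S :\ j) j)%:R.
  move=> m'm ij jm; apply: IH => //; first by rewrite !inE negb_and S0 orbT.
  move=> v jv; rewrite !inE Si ?(ltn_trans ij) // andbT.
  by rewrite -val_eqE gtn_eqF.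
rewrite npathsE rowE natrD natrD !natrM.
case: m im sub {IH} => [|m] im sub.
  have iE : i = N.+1 :> nat by rewrite addn0 in im.
  have -> : step_graph i ord0 = K.
    have n1 : next1 i = ord0 by rewrite /next1 iE ltnn.
    have n2 : next2 i = i by rewrite /next2 iE ltnNge leqnSn.
    have i0 : i == ord0 = false by rewrite -val_eqE /= iE.
    by rewrite mxE /heavy_light n1 n2 eqxx i0 muln1 addn0.
  rewrite expr0; apply: le_trans (_ : 2 * K%:R <= _); first by lra.
  by rewrite ler_pM2l // lerDl addr_ge0 ?mulr_ge0 ?ler0n.
have iN : (i < N.+1)%N by have := leq_addr m i.+1; rewrite addSnnS im.
have n1 := next1E iN.
have S1 : next1 i \in S by apply: Si; rewrite n1.
have H1 := sub m (next1 i) (ltnSn m); rewrite n1 addSn -addnS im in H1.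
have {}H1 := H1 (ltnSn i) erefl.
case: m im sub H1 => [|m] im sub H1.
  rewrite expr1; apply: le_trans alK _; rewrite S1 mul1r.
  rewrite expr0 in H1.
  have a0 : 0 <= (step_graph i ord0)%:R :> R := ler0n _ _.
  have b0 : 0 <= (next2 i \in S)%:R *
      (npaths ord0 (fun x y => step_graph x y) (S :\ next2 i) (next2 i))%:R :> R.
    by rewrite mulr_ge0 ?ler0n.
  have : 1 <= (npaths ord0 (fun x y => step_graph x y) (S :\ next1 i) (next1 i))%:R :> R.
    rewrite ler1n lt0n; apply: contraTneq H1 => ->; by rewrite mulr0 ler10.
  nra.
have iN' : (i < N)%N by have := leq_addr m i.+2; rewrite !addSnnS im.
have n2 := next2E iN'.
have S2 : next2 i \in S by apply: Si; rewrite n2 ltnW.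
have H2 : al ^+ m <= 2 * (npaths ord0 (fun x y => step_graph x y) (S :\ next2 i) (next2 i))%:R.
  by apply: sub; rewrite // n2 ?addSnnS // ltnW.
rewrite S1 S2 !mul1r.
have -> : al ^+ m.+2 = K%:R * al ^+ m.+1 + al ^+ m by rewrite !exprS mulrA -expr2 al2; ring.
have a0 : 0 <= (step_graph i ord0)%:R :> R := ler0n _ _.
have H1' : K%:R * al ^+ m.+1 <=
    K%:R * (2 * (npaths ord0 (fun x y => step_graph x y) (S :\ next1 i) (next1 i))%:R).
  by rewrite ler_pM2l // ltr0n.
lra.
Qed.

Lemma F_ge_expr : al ^+ N.+1 <= 2 * (F K.+1 N.+2)%:R.
Proof.
apply: le_trans (npaths_step_graph (S := [set~ ord0]) (i := ord0) _ _ _) _.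
- by rewrite add0n.
- by rewrite !inE eqxx.
- by move=> v; rewrite !inE -val_eqE lt0n.
rewrite ler_pM2l // ler_nat; apply: leq_trans (F_max step_graph_Gmulti).
by apply: npaths_le_num_cycles; rewrite !inE eqxx.
Qed.

End LowerBound.

(* Asymptotic statements *)
From mathcomp Require Import all_classical all_reals all_analysis.

Local Open Scope ring_scope.
Local Open Scope classical_set_scope.

Lemma alpha_gt0 (R : realType) k : 0 < alpha R k.
Proof.
rewrite /alpha divr_gt0 //; set x := k%:R - 1.
have x2 : 0 <= x ^+ 2 + 4 by rewrite addr_ge0 ?sqr_ge0.
have := sqr_sqrtr x2; have := sqrtr_ge0 (x ^+ 2 + 4).
move: (Num.sqrt _) => s s0 s2; rewrite ltNge; apply/negP => le; nra.
Qed.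

Lemma alpha_root (R : realType) K : alpha R K.+1 ^+ 2 = K%:R * alpha R K.+1 + 1.
Proof.
rewrite /alpha -natr1 addrK; have x2 : 0 <= K%:R ^+ 2 + 4 :> R by rewrite addr_ge0 ?sqr_ge0.
have := sqr_sqrtr x2; move: (Num.sqrt _) => s s2.
by rewrite expr_div_n sqrrD s2; field.
Qed.

Lemma eqTheta_bounds (R : realType) (f g : nat -> R) (c d : R) N : 0 < c -> 0 < d ->
  (forall n, (N <= n)%N -> 0 <= g n /\ c * g n <= f n <= d * g n) -> f =Theta_\oo g.
Proof.
move=> c0 d0 H; rewrite eqThetaE; apply/asboolP; exists (c, d); first by rewrite /= c0 d0.
exists N => // n /= Nn; have [g0 /andP[lo hi]] := H n Nn.
by rewrite (ger0_norm g0) ger0_norm // (le_trans _ lo) // mulr_ge0 // ltW.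
Qed.

Lemma F_Theta (R : realType) k : (2 <= k)%N ->
  (fun n : nat => (F k n)%:R : R) =Theta_\oo (fun n : nat => alpha R k ^+ n).
Proof.
case: k => [|K] // K0; rewrite ltnS in K0.
have al0 := alpha_gt0 R K.+1; have al2 := alpha_root R K.
move: (alpha R K.+1) al0 al2 => al al0 al2.
have al1 : 0 < al - 1 by rewrite subr_gt0 (al_gt1 K0).
(* The lower constant comes from [F_ge_expr], whose exponent is one less than the number of
   vertices, at least 2; the upper one is that of [num_cycles_le_expr]. *)
apply: (@eqTheta_bounds _ _ _ (2 * al)^-1 (K.+1%:R * (al / (al - 1))) 2).
- by rewrite invr_gt0 mulr_gt0.
- by rewrite mulr_gt0 ?ltr0n // divr_gt0.
case=> [|[|N]] // _; split; first by rewrite exprn_ge0 // ltW.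
apply/andP; split.
  rewrite ler_pdivrMl ?mulr_gt0 // exprS [2 * al]mulrC -mulrA ler_pM2l //.
  exact: F_ge_expr.
have [G GG ->] := F_attained K.+1 N.+2.
exact: num_cycles_le_expr.
Qed.

Lemma fib_Theta (R : realType) :
  (fun n : nat => alpha R 2 ^+ n) =Theta_\oo (fun n : nat => (fib n)%:R : R).
Proof.
have al0 := alpha_gt0 R 2; have al2 := alpha_root R 1; rewrite mul1r in al2.
move: (alpha R 2) al0 al2 => al al0 al2.
have al1 : 1 <= al by rewrite ltW // (@al_gt1 _ 1) // mul1r.
have fibS n : fib n.+2 = (fib n.+1 + fib n)%N by [].
have expS n : al ^+ n.+2 = al ^+ n.+1 + al ^+ n by rewrite !exprS mulrA -expr2 al2; ring.
have lo n : (fib n)%:R <= al ^+ n /\ (fib n.+1)%:R <= al ^+ n.+1.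
  elim: n => [|n [IH1 IH2]]; first by rewrite expr0 expr1 ler01.
  by split=> //; rewrite fibS expS natrD lerD.
have hi n : al ^+ n.+1 <= al ^+ 2 * (fib n.+1)%:R /\ al ^+ n.+2 <= al ^+ 2 * (fib n.+2)%:R.
  elim: n => [|n [IH1 IH2]].
    by rewrite expr1 /= !mulr1 expr2 ler_peMl // ltW.
  by split=> //; rewrite fibS expS natrD mulrDr lerD.
(* The upper bound fails at 0, where [fib] vanishes; the constant [al ^+ 2] is attained at 2, where
   [fib] is 1. *)
apply: (@eqTheta_bounds _ _ _ 1 (al ^+ 2) 1); rewrite ?exprn_gt0 //.
case=> // n _; split; first by rewrite ler0n.
by rewrite mul1r (proj2 (lo n)) (proj1 (hi n)).
Qed.

Theorem theorem3 (R : realType) :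
  (forall k : nat, (2 <= k)%N ->
     (fun n : nat => (F k n)%:R : R) =Theta_\oo (fun n : nat => alpha R k ^+ n)) /\
  (fun n : nat => (F 2 n)%:R : R) =Theta_\oo (fun n : nat => (fib n)%:R : R).
Proof.
by split; [exact: F_Theta|apply: eqTheta_trans (fib_Theta R); apply: F_Theta].
Qed.
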